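(* Let $n\ge 1$, let $\bar M^n$ be a compact smooth manifold (without boundary), let $0<T\le\infty$, and let $X:\bar M^n\times[0,T)\to\mathbb{R}^{n+1}$ be a smooth family of smooth embeddings $X(\cdot,t)$ evolving by mean curvature flow $$\frac{\partial X}{\partial t}(x,t)=-H(x,t)\,\nu(x,t),$$ where $\nu(x,t)$ is the outward unit normal and $H(x,t)$ the mean curvature of the hypersurface $M_t=X(\bar M,t)$ at $X(x,t)$. Assume that $H(x,t)>0$ for all $(x,t)\in\bar M\times[0,T)$. If $M_0=X(\bar M,0)$ is $\delta$-non-collapsed for some $\delta>0$, then $M_t=X(\bar M,t)$ is $\delta$-non-collapsed (with the same $\delta$) for every $t\in[0,T)$.
   Context: Each $M_t$ bounds an open region $\Omega_t\subset\mathbb{R}^{n+1}$ (i.e. $M_t=\partial\Omega_t$, with $\Omega_t$ lying locally on one side of $M_t$), and $\nu(\cdot,t)$ is the unit normal pointing out of $\Omega_t$; it depends continuously on $t$. The second fundamental form is $h_{ij}=-\langle \partial_i\partial_j X,\nu\rangle$ and the mean curvature $H=g^{ij}h_{ij}$ is its trace (the sum of the principal curvatures), so that round spheres bounding balls have $H>0$. A hypersurface is called mean-convex if $H>0$ everywhere on it. Definition ($\delta$-non-collapsed). Let $\delta>0$. A mean-convex embedded hypersurface $M$ bounding an open region $\Omega$ in $\mathbb{R}^{n+1}$ is $\delta$-non-collapsed if for every $x\in M$ there is an open ball $B$ of radius $\delta/H(x)$ with $B\subset\Omega$ and $x\in\partial B$. *)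

(* Defs.v *)
From HB Require Import structures.
From mathcomp Require Import all_boot all_order all_algebra.
From mathcomp Require Import all_classical all_reals all_analysis.

Set Implicit Arguments.
Unset Strict Implicit.
Unset Printing Implicit Defensive.

Import Order.TTheory GRing.Theory Num.Theory.
Import numFieldNormedType.Exports.

Local Open Scope classical_set_scope.
Local Open Scope ring_scope.

(* The library norm on 'rV[R]_m is the sup norm: it gives the right topology
   and derivatives, but not the Euclidean balls, hence [dot] and [enorm]. *)
Definition dot (R : realType) (m : nat) (u v : 'rV[R]_m) : R :=
  \sum_(i < m) u 0 i * v 0 i.

Definition enorm (R : realType) (m : nat) (u : 'rV[R]_m) : R :=
  Num.sqrt (dot u u).

Definition eball (R : realType) (m : nat) (c : 'rV[R]_m) (r : R) :
    set 'rV[R]_m :=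
  [set y | enorm (y - c) < r].

Definition boundary (T : topologicalType) (A : set T) : set T :=
  closure A `\` interior A.

(* Only used with V and W finite-dimensional. *)
Fixpoint Ck (R : realType) (V W : normedModType R) (k : nat) (U : set V)
    (f : V -> W) : Prop :=
  match k with
  | 0%N => forall x, U x -> {for x, continuous f}
  | k'.+1 => (forall x, U x -> differentiable f x) /\
             (forall v : V, Ck k' U (fun x => 'D_v f x))
  end.

Definition smooth_on_open (R : realType) (V W : normedModType R) (U : set V)
    (f : V -> W) : Prop :=
  forall k : nat, Ck k U f.

(* Smoothness on an arbitrary subset: local existence of smooth extensions. *)
Definition smooth_on (R : realType) (V W : normedModType R) (A : set V)
    (f : V -> W) : Prop :=
  forall a, A a -> exists (U : set V) (g : V -> W),
    [/\ open_nbhs a U, smooth_on_open U g & {in A `&` U, f =1 g}].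

(* A homeomorphism between an open set of T and an open set of R^n; [cmap] and
   [cinv] are total functions, meaningful on [cdom] and [cimg] only. *)
Record chart (R : realType) (n : nat) (T : topologicalType) := Chart {
  cdom : set T;
  cimg : set 'rV[R]_n;
  cmap : T -> 'rV[R]_n;
  cinv : 'rV[R]_n -> T;
  cdom_open : open cdom;
  cimg_open : open cimg;
  cmap_img : forall x, cdom x -> cimg (cmap x);
  cinv_dom : forall u, cimg u -> cdom (cinv u);
  cmapK : forall x, cdom x -> cinv (cmap x) = x;
  cinvK : forall u, cimg u -> cmap (cinv u) = u;
  cmap_continuous : forall x, cdom x -> {for x, continuous cmap};
  cinv_continuous : forall u, cimg u -> {for u, continuous cinv}
}.

(* The atlas need not be maximal. *)
Record smoothManifold (R : realType) (n : nat) := SmoothManifold {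
  carrier :> topologicalType;
  atlas : set (chart R n carrier);
  manifold_hausdorff : hausdorff_space carrier;
  manifold_second_countable : @second_countable carrier;
  atlas_cover : forall x : carrier, exists c, atlas c /\ cdom c x;
  atlas_compatible : forall c d, atlas c -> atlas d ->
    smooth_on_open (cmap c @` (cdom c `&` cdom d)) (cmap d \o cinv c)
}.

Definition chart_at (R : realType) (n : nat) (M : smoothManifold R n) (x : M) :
    chart R n M :=
  projT1 (cid (atlas_cover x)).

Section Hypersurface.
Variables (R : realType) (n : nat) (M : smoothManifold R n).
Implicit Types (F nu : M -> 'rV[R]_n.+1) (Omega : set 'rV[R]_n.+1) (x : M).

Definition smooth_map F : Prop :=
  forall c, atlas c -> smooth_on_open (cimg c) (F \o cinv c).

Definition immersion F : Prop :=
  forall c, atlas c -> forall u, cimg c u ->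
  forall v, 'D_v (F \o cinv c) u = 0 -> v = 0.

Definition topological_embedding F : Prop :=
  [/\ continuous F, injective F &
      forall U : set M, open U ->
        exists2 V : set 'rV[R]_n.+1, open V & F @` U = V `&` range F].

Definition smooth_embedding F : Prop :=
  [/\ smooth_map F, immersion F & topological_embedding F].

(* [nu] is the unit normal field of the hypersurface F(M) pointing out of
   Omega.  The last clause says at once that Omega lies locally on one side of
   F(M) and that [nu] points to the other side. *)
Definition outward_unit_normal F Omega nu : Prop :=
  [/\ forall x, dot (nu x) (nu x) = 1,
      forall c, atlas c -> forall u, cimg c u ->
        forall v, dot ('D_v (F \o cinv c) u) (nu (cinv c u)) = 0 &
      forall x, exists2 e : R, 0 < e &
        forall s, 0 < s < e ->
          Omega (F x - s *: nu x) /\ ~ closure Omega (F x + s *: nu x)].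

Definition bounds F Omega : Prop := open Omega /\ boundary Omega = range F.

Definition partial (m : nat) (f : 'rV[R]_n -> 'rV[R]_m) (i : 'I_n) :
    'rV[R]_n -> 'rV[R]_m :=
  fun u => 'D_(delta_mx 0 i) f u.

Definition first_fundamental_form (c : chart R n M) F x : 'M[R]_n :=
  \matrix_(i, j) dot (partial (F \o cinv c) i (cmap c x))
                     (partial (F \o cinv c) j (cmap c x)).

Definition second_fundamental_form (c : chart R n M) F nu x : 'M[R]_n :=
  \matrix_(i, j)
    - dot (partial (partial (F \o cinv c) j) i (cmap c x)) (nu x).

(* H = g^{ij} h_{ij}; the value does not depend on the chart around x. *)
Definition mean_curvature F nu x : R :=
  let c := chart_at x in
  \tr (invmx (first_fundamental_form c F x) *m second_fundamental_form c F nu x).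

(* To be used for a mean-convex embedded hypersurface F(M) bounding Omega, with
   outward unit normal [nu]. *)
Definition noncollapsed (delta : R) F Omega nu : Prop :=
  forall x, exists c : 'rV[R]_n.+1,
    let B := eball c (delta / mean_curvature F nu x) in
    B `<=` Omega /\ boundary B (F x).

(* [0, T) as a set of reals, 0 < T <= +oo *)
Definition time_interval (T : \bar R) : set R :=
  [set t | 0 <= t /\ (t%:E < T)%E].

Definition smooth_family (T : \bar R) (X : M -> R -> 'rV[R]_n.+1) : Prop :=
  forall c, atlas c ->
    smooth_on (cimg c `*` time_interval T)
      (fun p : 'rV[R]_n * R => X (cinv c p.1) p.2).

(* f'(t) = l for a curve f defined on I; one-sided at the end points of I. *)
Definition has_derivative_within (I : set R) (f : R -> 'rV[R]_n.+1) (t : R)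
    (l : 'rV[R]_n.+1) : Prop :=
  (s - t)^-1 *: (f s - f t) @[s --> within I t^'] --> l.

Definition mean_curvature_flow (T : \bar R) (X nu : M -> R -> 'rV[R]_n.+1) :
    Prop :=
  forall x t, time_interval T t ->
    has_derivative_within (time_interval T) (X x) t
      (- mean_curvature (X^~ t) (nu^~ t) x *: nu x t).

End Hypersurface.

(* Main.v *)
(* Following Andrews, let Z(x, y, t) = H(x)/2 |X(y) - X(x)|^2
   + delta <X(y) - X(x), nu(x)>.  Completing the square, Z(x, y, t) >= 0 for all y
   says that M_t does not enter the ball of radius delta/H(x) that touches M_t at
   X(x) from inside, so that non-collapsedness at time t is nonnegativity of Z.
   At a spatial minimum of Z, put rho = <H (X(y) - X(x)) + delta nu(x), nu(y)>;
   first-order criticality at y gives rho^2 = delta^2 + 2 H Z.  The Hessian of Z,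
   traced over pairs of tangent vectors at x and y that project the same ambient
   basis vector, together with the Codazzi equation, the evolution equation
   H_t = Lap H + |A|^2 H and criticality in x, gives
     Z_t >= (|A|^2 + 2 <grad H, nu(y)> / rho) Z,
   where rho^2 is close to delta^2 when Z is close to 0.  On [0, t1] the coefficient
   is bounded, hence for K large and eps small Z + eps exp(K t) cannot reach 0. *)

Require Import Defs.
From HB Require Import structures.
From mathcomp Require Import all_boot all_order all_algebra.
From mathcomp Require Import all_classical all_reals all_analysis.
From mathcomp Require Import ring lra.

Set Implicit Arguments.
Unset Strict Implicit.
Unset Printing Implicit Defensive.

Import Order.TTheory GRing.Theory Num.Theory.
Import numFieldNormedType.Exports.

Local Open Scope classical_set_scope.
Local Open Scope ring_scope.

(** * Differential calculus on normed modules *)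

(** The minimum of Z is studied in two unrelated charts, around x and around y, without normal
    coordinates or covariant derivatives. The lifts of the projected basis vectors are frozen at the
    point, so second derivatives along them carry first-order chart terms; together these are
    derivatives of Z along tangent vectors and vanish by criticality. As one ambient basis is
    projected at both points, the difference of paired vectors is a combination of the two normals:
    no frame has to be aligned with the chord, and x = y is not a special case. The sign of rho is
    never determined; a lower bound for rho^2 suffices. Smoothness is given for X, on a time
    interval closed at 0. Hence X is extended locally across time 0, and H and nu are recovered from
    X_t = - H nu. The extension follows the flow only at times in [0, T), so geometric identities
    live on patches with t > 0, while continuity and bounds hold across t = 0. This fits the maximum
    principle: Z >= 0 initially makes the first touching time positive. That time is the minimum of
    t over a compact sublevel set, so the minimum of Z over x and y is never differentiated in t. *)

Section Calculus.
Variables (R : realType).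

Lemma near_eq_differentiable (V W : normedModType R) (f g : V -> W) (x : V) :
  (\near x, f x = g x) -> differentiable f x -> differentiable g x.
Proof.
move=> fg df.
suff dh : differentiable (g - f) x.
  by rewrite -[g](subrK f); exact: differentiableD.
have fgx : f x = g x by exact: nbhs_singleton fg.
(* The zero map, taken as a differential so that it comes packaged as a linear map. *)
pose l := 'd (cst (0 : W)) x.
have l0 : (l : V -> W) = 0 by rewrite /l diff_cst.
have hE : (g - f) \o shift x = cst ((g - f) x) + l +o_ 0 id.
  apply/eqaddoP => e e0; rewrite near_simpl.
  have := fg; rewrite (near_shift 0) subr0.
  apply: filterS => y /= fgy.
  rewrite l0 [X in `|X|](_ : _ = g (y + x) - f (y + x) - (g x - f x + 0))//.
  by rewrite fgy fgx !subrr addr0 subrr normr0 mulr_ge0// ltW.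
have c0 : continuous (l : V -> W) by rewrite l0; move=> y; exact: cst_continuous.
by apply/diff_locallyP; rewrite (diff_unique c0 hE).
Qed.

(** * Closure properties of [Ck] and smooth functions *)

Section Scalar.
Variable V : normedModType R.
Implicit Types (U : set V) (f g : V -> R) (x y v w : V).

Lemma Ck_congr (W : normedModType R) k U (f g : V -> W) :
  open U -> (forall x, U x -> f x = g x) -> Ck k U f -> Ck k U g.
Proof.
move=> oU; elim: k f g => [|k IH] f g fg /=.
  move=> cf x Ux; have nfg : \near x, f x = g x.
    by apply: filterS (open_nbhs_nbhs (conj oU Ux)) => y; exact: fg.
  rewrite /prop_for /continuous_at -(fg _ Ux).
  by apply: cvg_trans (cf x Ux); apply: near_eq_cvg.
move=> [df Df]; split=> [x Ux|v].
  apply: near_eq_differentiable (df x Ux).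
  by apply: filterS (open_nbhs_nbhs (conj oU Ux)) => y; exact: fg.
apply: (IH _ _ _ (Df v)) => x Ux; apply: near_eq_derive.
by apply: filterS (open_nbhs_nbhs (conj oU Ux)) => y; exact: fg.
Qed.

Lemma Ck_subset (W : normedModType R) k U U' (f : V -> W) :
  U' `<=` U -> Ck k U f -> Ck k U' f.
Proof.
move=> sU; elim: k f => [|k IH] f /=; first by move=> cf x /sU; exact: cf.
by move=> [df Df]; split=> [x /sU|v]; [exact: df|exact: IH].
Qed.

Lemma Ck_pred (W : normedModType R) k U (f : V -> W) : Ck k.+1 U f -> Ck k U f.
Proof.
elim: k f => [|k IH] f.
  by move=> [df _] x Ux; apply: differentiable_continuous; exact: df.
by move=> [df Df]; split=> // v; apply: IH.
Qed.

Lemma CkD k U f g : open U -> Ck k U f -> Ck k U g -> Ck k U (fun x => f x + g x).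
Proof.
move=> oU; elim: k f g => [|k IH] f g /=.
  by move=> cf cg x Ux; apply: continuousD; [exact: cf|exact: cg].
move=> [df Df] [dg Dg]; split=> [x Ux|v].
  by apply: differentiableD; [exact: df|exact: dg].
apply: Ck_congr (IH _ _ (Df v) (Dg v)) => // x Ux.
by rewrite -deriveD//; apply: diff_derivable; [exact: df|exact: dg].
Qed.

Lemma Ck_cst k U (c : R) : Ck k U (fun=> c).
Proof.
elim: k c => [|k IH] c /=; first by move=> x _; exact: cst_continuous.
split=> [x _|v]; first exact: differentiable_cst.
rewrite (_ : 'D_v _ = fun=> 0); first exact: IH.
by apply/funext => x; rewrite derive_cst.
Qed.

Lemma CkM k U f g : open U -> Ck k U f -> Ck k U g -> Ck k U (fun x => f x * g x).
Proof.
move=> oU; elim: k f g => [|k IH] f g.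
  by move=> cf cg x Ux; apply: continuousM; [exact: cf|exact: cg].
move=> Cf Cg; have [df Df] := Cf; have [dg Dg] := Cg; split=> [x Ux|v].
  by apply: differentiableM; [exact: df|exact: dg].
apply: (Ck_congr (f := fun x => f x * 'D_v g x + g x * 'D_v f x)) => // [x Ux|].
  by rewrite deriveM//; apply: diff_derivable; [exact: df|exact: dg].
by apply: CkD => //; apply: IH; [exact: Ck_pred Cf|exact: Dg|exact: Ck_pred Cg|exact: Df].
Qed.

Lemma derive_comp_scalar f (g : R -> R) x v :
  differentiable f x -> derivable g (f x) 1 ->
  'D_v (g \o f) x = 'D_1 g (f x) * 'D_v f x.
Proof.
move=> df /derivable1_diffP dg.
rewrite deriveE; last exact: differentiable_comp.
rewrite diff_comp//= (deriveE _ df) (deriveE _ dg).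
by rewrite -[X in 'd g _ X]mulr1 linearZ mulrC.
Qed.

(** Differentiation lowers the exponent by one, so the induction must quantify over [a]. The
    exponents 1/2 and -1 later give square roots and inverses. *)
Lemma Ck_powR k U f (a : R) : open U -> (forall x, U x -> 0 < f x) ->
  Ck k U f -> Ck k U (fun x => f x `^ a).
Proof.
move=> oU f0; elim: k a => [|k IH] a Cf.
  move=> x Ux; apply: (@continuous_comp V R R f (fun y : R => y `^ a) x); first exact: Cf.
  have [+ _] := is_derive1_powR a (f0 x Ux).
  by move=> /derivable1_diffP/differentiable_continuous.
have [df Df] := Cf; split=> [x Ux|v].
  apply: (@differentiable_comp R V R R f (fun y : R => y `^ a) x); first exact: df.
  by have [+ _] := is_derive1_powR a (f0 x Ux); move=> /derivable1_diffP.
apply: (Ck_congr (f := fun x => a * f x `^ (a - 1) * 'D_v f x)) => // [x Ux|].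
  have [dp <-] := is_derive1_powR a (f0 x Ux).
  by rewrite -derive_comp_scalar//; exact: df.
apply: CkM => //; last exact: Df.
by apply: CkM => //; [exact: Ck_cst|apply: IH; exact: Ck_pred Cf].
Qed.

Lemma Ck_coord m n k U (F : V -> 'M[R]_(m, n)) i j : open U ->
  Ck k U F -> Ck k U (fun x => F x i j).
Proof.
move=> oU; elim: k F => [|k IH] F.
  move=> cF x Ux; apply: (@continuous_comp _ _ _ F (fun A : 'M[R]_(m, n) => A i j)).
    exact: cF.
  exact: coord_continuous.
move=> [dF DF]; split=> [x Ux|v].
  apply: (@differentiable_comp _ _ _ _ F (fun A : 'M[R]_(m, n) => A i j : R)).
    exact: dF.
  exact: differentiable_coord.
apply: Ck_congr (IH _ (DF v)) => // x Ux.
by rewrite derive_mx ?mxE//; apply: diff_derivable; exact: dF.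
Qed.

Local Notation smooth := smooth_on_open.

Lemma smooth_congr U f g : open U -> (forall x, U x -> f x = g x) ->
  smooth U f -> smooth U g.
Proof. by move=> oU fg sf k; apply: Ck_congr (sf k). Qed.

Lemma smooth_subset U U' f : U' `<=` U -> smooth U f -> smooth U' f.
Proof. by move=> sU sf k; apply: Ck_subset (sf k). Qed.

Lemma smooth_differentiable U f x : smooth U f -> U x -> differentiable f x.
Proof. by move=> /(_ 1%N)[+ _]; exact. Qed.

Lemma smooth_derivable U f x v : smooth U f -> U x -> derivable f x v.
Proof. by move=> sf Ux; exact/diff_derivable/(smooth_differentiable sf Ux). Qed.

Lemma smooth_continuous U f x : smooth U f -> U x -> {for x, continuous f}.
Proof. by move=> /(_ 0%N); exact. Qed.

Lemma smooth_derive U f v : smooth U f -> smooth U ('D_v f).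
Proof. by move=> sf k; have [_] := sf k.+1; exact. Qed.

Lemma smooth_cst U (c : R) : smooth U (fun=> c).
Proof. by move=> k; exact: Ck_cst. Qed.

Lemma smoothD U f g : open U -> smooth U f -> smooth U g ->
  smooth U (fun x => f x + g x).
Proof. by move=> oU sf sg k; exact: CkD. Qed.

Lemma smoothM U f g : open U -> smooth U f -> smooth U g ->
  smooth U (fun x => f x * g x).
Proof. by move=> oU sf sg k; exact: CkM. Qed.

Lemma smoothN U f : open U -> smooth U f -> smooth U (fun x => - f x).
Proof.
move=> oU sf; rewrite (_ : (fun x => - f x) = fun x => -1 * f x).
  by apply: smoothM => //; exact: smooth_cst.
by apply/funext => x; rewrite mulN1r.
Qed.

Lemma smoothB U f g : open U -> smooth U f -> smooth U g ->
  smooth U (fun x => f x - g x).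
Proof. by move=> oU sf sg; apply: smoothD => //; exact: smoothN. Qed.

Lemma smooth_powR U f (a : R) : open U -> (forall x, U x -> 0 < f x) ->
  smooth U f -> smooth U (fun x => f x `^ a).
Proof. by move=> oU f0 sf k; exact: Ck_powR. Qed.

Lemma smooth_sum (I : Type) (r : seq I) (P : pred I) U (F : I -> V -> R) :
  open U -> (forall i, smooth U (F i)) ->
  smooth U (fun x => \sum_(i <- r | P i) F i x).
Proof.
move=> oU sF; elim: r => [|i r IH].
  by under eq_fun do rewrite big_nil; exact: smooth_cst.
under eq_fun do rewrite big_cons; case: (P i) => //.
exact: smoothD.
Qed.

Lemma smooth_prod (I : Type) (r : seq I) (P : pred I) U (F : I -> V -> R) :
  open U -> (forall i, smooth U (F i)) ->
  smooth U (fun x => \prod_(i <- r | P i) F i x).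
Proof.
move=> oU sF; elim: r => [|i r IH].
  by under eq_fun do rewrite big_nil; exact: smooth_cst.
under eq_fun do rewrite big_cons; case: (P i) => //.
exact: smoothM.
Qed.

Lemma smooth_coord m n U (F : V -> 'M[R]_(m, n)) i j : open U ->
  smooth_on_open U F -> smooth U (fun x => F x i j).
Proof. by move=> oU sF k; exact: Ck_coord. Qed.

End Scalar.

(** * Restriction to lines, mixed derivatives, second derivative test *)

Section Lines.
Variable V : normedModType R.
Implicit Types (U : set V) (f g : V -> R) (x y v w : V).
Local Notation smooth := smooth_on_open.

Lemma derive_line (W : normedModType R) (f : V -> W) x v (s : R) :
  'D_1 (fun s : R => f (x + s *: v)) s = 'D_v f (x + s *: v).
Proof.
suff E : (fun h : R => h^-1 *: (((fun s : R => f (x + s *: v)) \o shift s) (h *: 1)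
    - f (x + s *: v))) =
  (fun h : R => h^-1 *: ((f \o shift (x + s *: v)) (h *: v) - f (x + s *: v))).
  by rewrite /derive E.
by apply/funext => h /=; rewrite scalerDl addrCA [h *: 1]mulr1.
Qed.

Lemma derive_translate (W : normedModType R) (f : V -> W) c v y :
  'D_v (fun y => f (y + c)) y = 'D_v f (y + c).
Proof.
suff E : (fun h : R => h^-1 *: (((fun y => f (y + c)) \o shift y) (h *: v)
    - f (y + c))) =
  (fun h : R => h^-1 *: ((f \o shift (y + c)) (h *: v) - f (y + c))).
  by rewrite /derive E.
by apply/funext => h /=; rewrite addrA.
Qed.

Lemma line_continuous x v : continuous (fun s : R => x + s *: v).
Proof.
by move=> s; apply: cvgD; [exact: cvg_cst|exact: scalel_continuous].
Qed.

Lemma line_open U x v : open U -> open [set s : R | U (x + s *: v)].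
Proof. by move=> oU; apply: open_comp => // s _; exact: line_continuous. Qed.

Lemma differentiable_line x v s : differentiable (fun s : R => x + s *: v) s.
Proof.
apply: (@differentiableD _ _ _ (cst x)); first exact: differentiable_cst.
by apply: ex_diff; exact: is_diff_scalel.
Qed.

Lemma smooth_line U f x v : open U -> smooth U f ->
  smooth [set s : R | U (x + s *: v)] (fun s : R => f (x + s *: v)).
Proof.
move=> oU sf k; elim: k f sf => [|k IH] f sf.
  move=> s Us; apply: (@continuous_comp _ _ _ (fun s : R => x + s *: v) f).
    exact: line_continuous.
  exact: smooth_continuous sf Us.
split=> [s Us|w].
  apply: (@differentiable_comp _ _ _ _ (fun s : R => x + s *: v) f).
    exact: differentiable_line.
  exact: smooth_differentiable sf Us.
(* A direction [w] of [R] is a scalar, so the derivative along [w] is [w] times the derivative along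
   1. *)
apply: (@Ck_congr R R k _ (fun s : R => w * 'D_v f (x + s *: v))).
- exact: line_open.
- move=> s Us; rewrite -derive_line.
  have ds : differentiable (fun s : R => f (x + s *: v)) s.
    apply: (@differentiable_comp _ _ _ _ (fun s : R => x + s *: v) f).
      exact: differentiable_line.
    exact: smooth_differentiable sf Us.
  by rewrite !deriveE// -[in RHS](mulr1 w) [RHS]linearZ.
- apply: CkM; [exact: line_open|exact: Ck_cst|].
  exact: (IH ('D_v f) (smooth_derive v sf)).
Qed.

Lemma mvt_line f x v (h : R) : 0 < h ->
  (forall s : R, 0 <= s <= h -> differentiable f (x + s *: v)) ->
  exists2 c : R, 0 < c < h & f (x + h *: v) - f x = h * 'D_v f (x + c *: v).
Proof.
move=> h0 df.
have dfl (s : R) : 0 <= s <= h -> derivable (fun s : R => f (x + s *: v)) s 1.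
  move=> sh; apply/derivable1_diffP.
  apply: (@differentiable_comp _ _ _ _ (fun s : R => x + s *: v) f).
    exact: differentiable_line.
  exact: df.
have [||c] := @MVT _ (fun s : R => f (x + s *: v)) (fun s : R => 'D_v f (x + s *: v)) 0 h h0.
- move=> s; rewrite in_itv/= => /andP[s0 sh]; rewrite -derive_line.
  by apply: derivableP; apply: dfl; rewrite !ltW.
- by apply: derivable_within_continuous => s; rewrite in_itv/= => sh; exact: dfl.
rewrite in_itv/= scale0r addr0 subr0 mulrC.
move=> ch fE.
by exists c.
Qed.

(** The mean value theorem is applied along [v] to the increment [g y = f (y + h *: w) - f y], then
    along [w] to ['D_v f]. The intermediate point lies in the parallelogram spanned by [h *: v] and
    [h *: w], hence in [P] for small [h]. *)
Lemma mvt_line2 U f x v w (P : set V) : open U -> smooth U f -> U x ->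
  (\forall y \near x, P y) ->
  \forall h \near 0^'+, exists2 y, P y &
    f (x + h *: v + h *: w) - f (x + h *: v) - (f (x + h *: w) - f x)
      = h ^+ 2 * 'D_w ('D_v f) y.
Proof.
move=> oU sf Ux nP.
have /nbhs_ballP[r /= r0 rP] : \forall y \near x, P y /\ U y.
  by apply: filterI => //; exact: open_nbhs_nbhs.
have rb a b : `|a| * `|v| + `|b| * `|w| < r -> P (x + a *: v + b *: w) /\ U (x + a *: v + b *: w).
  move=> ab; apply: rP; rewrite -ball_normE /ball_/= -addrA opprD addrA subrr add0r normrN.
  by apply: le_lt_trans ab; rewrite -!normrZ ler_normD.
near=> h.
have h0 : 0 < h by near: h; exact: nbhs_right_gt.
have hr : h * `|v| + h * `|w| < r.
  have : h < r / (`|v| + `|w| + 1).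
    near: h; by apply: nbhs_right_lt; rewrite divr_gt0// ltr_wpDl ?addr_ge0.
  rewrite ltr_pdivlMr ?ltr_wpDl ?addr_ge0// => hr.
  by rewrite -mulrDr; apply: le_lt_trans hr; rewrite ler_pM2l// lerDl.
have hb a b : 0 <= a <= h -> 0 <= b <= h -> P (x + a *: v + b *: w) /\ U (x + a *: v + b *: w).
  move=> /andP[a0 ah] /andP[b0 bh]; apply: rb; apply: le_lt_trans hr.
  by rewrite !ger0_norm// lerD// ler_wpM2r.
pose g y := f (y + h *: w) - f y.
have dg y : U y -> U (y + h *: w) -> differentiable g y.
  move=> Uy Uy'; apply: differentiableB.
    apply: (@differentiable_comp _ _ _ _ (fun y => y + h *: w) f).
      by apply: differentiableD; [exact: ex_diff|exact: differentiable_cst].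
    exact: smooth_differentiable sf Uy'.
  exact: smooth_differentiable sf Uy.
have Dg y : U y -> U (y + h *: w) -> 'D_v g y = 'D_v f (y + h *: w) - 'D_v f y.
  move=> Uy Uy'; rewrite -derive_translate -deriveB//.
    apply: diff_derivable; apply: (@differentiable_comp _ _ _ _ (fun y => y + h *: w) f).
      by apply: differentiableD; [exact: ex_diff|exact: differentiable_cst].
    exact: smooth_differentiable sf Uy'.
  exact: smooth_derivable sf Uy.
have h0' : 0 <= h by exact: ltW.
have U1 (s : R) : 0 <= s <= h -> U (x + s *: v).
  move=> sh; have [|_] := hb _ 0 sh; first by rewrite lexx.
  by rewrite scale0r addr0.
have U2 (s : R) : 0 <= s <= h -> U (x + s *: v + h *: w).
  by move=> sh; have [|_] := hb _ h sh; first by rewrite h0' lexx.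
have [s sh|a /andP[a0 ah] gE] := @mvt_line g x v h h0.
  by apply: dg; [exact: U1|exact: U2].
have a0h : 0 <= a <= h by rewrite !ltW.
have [s sh|b /andP[b0 bh] DgE] := @mvt_line ('D_v f) (x + a *: v) w h h0.
  apply: smooth_differentiable (smooth_derive _ sf) _.
  by have [] := hb _ _ a0h sh.
have b0h : 0 <= b <= h by rewrite !ltW.
exists (x + a *: v + b *: w); first by have [] := hb _ _ a0h b0h.
rewrite -[LHS]/(g (x + h *: v) - g x) gE Dg ?DgE ?mulrA//; [exact: U1|exact: U2].
Unshelve. all: by end_near. Qed.

Let normB2 (e a b c d : R) : `|a - b| < e / 2 -> `|c - d| < e / 2 ->
  `|a - b - (c - d)| <= e.
Proof.
move=> ab cd; apply: (le_trans (ler_normB _ _)).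
by rewrite (splitr e) lerD// ltW.
Qed.

(** Schwarz's theorem: the second difference over a parallelogram is symmetric in its sides, so the
    two mixed derivatives agree at two points near [x], and continuity moves both to [x]. *)
Lemma derive_comm U f x v w : open U -> smooth U f -> U x ->
  'D_v ('D_w f) x = 'D_w ('D_v f) x.
Proof.
move=> oU sf Ux; apply/eqP; rewrite -subr_eq0 -normr_le0; apply/ler_addgt0Pl => e e0.
rewrite addr0.
have c1 : {for x, continuous ('D_v ('D_w f))}.
  by apply: smooth_continuous Ux; do 2 apply: smooth_derive; exact: sf.
have c2 : {for x, continuous ('D_w ('D_v f))}.
  by apply: smooth_continuous Ux; do 2 apply: smooth_derive; exact: sf.
have e2 : 0 < e / 2 by rewrite divr_gt0.
have n1 := mvt_line2 w v oU sf Ux ((cvgrPdist_lt _ _).1 c1 _ e2).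
have n2 := mvt_line2 v w oU sf Ux ((cvgrPdist_lt _ _).1 c2 _ e2).
have n3 : \forall h \near (0 : R)^'+, 0 < h by exact: nbhs_right_gt.
have /filter_ex[h [h0 [[y1 /= Py1 E1] [y2 /= Py2 E2]]]] : \forall h \near (0 : R)^'+,
    0 < h /\ ((exists2 y, `|'D_v ('D_w f) x - 'D_v ('D_w f) y| < e / 2 &
    f (x + h *: w + h *: v) - f (x + h *: w) - (f (x + h *: v) - f x)
      = h ^+ 2 * 'D_v ('D_w f) y) /\
    (exists2 y, `|'D_w ('D_v f) x - 'D_w ('D_v f) y| < e / 2 &
    f (x + h *: v + h *: w) - f (x + h *: v) - (f (x + h *: w) - f x)
      = h ^+ 2 * 'D_w ('D_v f) y)).
  by apply: filterI; [exact: n3|apply: filterI; [exact: n1|exact: n2]].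
have E : 'D_v ('D_w f) y1 = 'D_w ('D_v f) y2.
  apply: (mulfI (x := h ^+ 2)); first by rewrite expf_neq0// gt_eqF.
  by rewrite -E1 -E2 -!addrA [h *: w + h *: v]addrC; ring.
have -> : 'D_v ('D_w f) x - 'D_w ('D_v f) x =
   ('D_v ('D_w f) x - 'D_v ('D_w f) y1) - ('D_w ('D_v f) x - 'D_w ('D_v f) y2).
  have sub3 (a b c : R) : a - c = (a - b) - (c - b) by ring.
  by rewrite -E; exact: sub3.
exact: normB2 Py1 Py2.
Qed.

End Lines.

Lemma second_derivative_test (U : set R) (f : R -> R) :
  open U -> smooth_on_open U f -> U 0 -> (\forall s \near 0, f 0 <= f s) ->
  'D_1 f 0 = 0 /\ 0 <= 'D_1 ('D_1 f) 0.
Proof.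
move=> oU sf U0 fmin.
have /nbhs_ballP[r /= r0 rP] : \forall y \near (0:R), f 0 <= f y /\ U y.
  by apply: filterI => //; exact: open_nbhs_nbhs.
have rb (s : R) : `|s| < r -> f 0 <= f s /\ U s.
  by move=> sr; apply: rP; rewrite -ball_normE /ball_/= sub0r normrN.
have D0 : 'D_1 f 0 = 0.
  have [||||] := @derive1_at_min _ f (- r) r 0.
  - by rewrite ge0_cp ?ltW.
  - move=> t; rewrite in_itv/= -ltr_norml => /rb[_ Ut].
    exact: smooth_derivable sf Ut.
  - by rewrite in_itv/= oppr_lt0 r0.
  - by move=> t; rewrite in_itv/= -ltr_norml => /rb[].
  - by [].
(* Were the second derivative negative, ['D_1 f] would be negative just to the right of 0 and the
   mean value theorem would put [f m] below [f 0]. *)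
split=> //; rewrite leNgt; apply/negP => D2.
have : derivable ('D_1 f) 0 1.
  by apply: smooth_derivable (smooth_derive _ sf) U0.
move=> /cvgr_lt/(_ 0 D2); rewrite D0.
move=> /nbhs_ballP[d /= d0 dP].
pose m := Num.min r d / 2.
have m0 : 0 < m by rewrite divr_gt0// lt_min r0.
have md : m < Num.min r d by rewrite /m ltr_pdivrMr// ltr_pMr ?lt_min ?r0// ltr1n.
move: md; rewrite lt_min => /andP[mr md].
have [s /andP[s0 sm]|c /andP[c0 cm]] := @mvt_line _ f 0 1 m m0.
  apply: (smooth_differentiable sf); rewrite add0r [s *: 1]mulr1.
  by apply: (rb _ _).2; rewrite ger0_norm// (le_lt_trans sm).
rewrite !add0r [m *: 1]mulr1 [c *: 1]mulr1 => fE.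
have : 0 <= m * 'D_1 f c.
  by rewrite -fE subr_ge0; apply: (rb _ _).1; rewrite gtr0_norm.
rewrite pmulr_rge0// leNgt => /negP; apply.
have := dP c; rewrite -ball_normE /ball_/= sub0r normrN gtr0_norm// (lt_trans cm md).
move=> /(_ isT); rewrite gt_eqF// => /(_ isT).
rewrite [c *: 1]mulr1 addr0 subr0.
by rewrite -[_ *: _]/(c^-1 * _) pmulr_rlt0 ?invr_gt0.
Qed.

End Calculus.

(** * The critical point inequality *)

Section Dot.
Variables (R : realType) (m : nat).
Implicit Types (u v w : 'rV[R]_m) (a : R).

Lemma dotC u v : dot u v = dot v u.
Proof. by apply: eq_bigr => i _; rewrite mulrC. Qed.

Lemma dotDl u v w : dot (u + v) w = dot u w + dot v w.
Proof. by rewrite -big_split; apply: eq_bigr => i _; rewrite mxE mulrDl. Qed.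

Lemma dotZl a u w : dot (a *: u) w = a * dot u w.
Proof. by rewrite [RHS]big_distrr; apply: eq_bigr => i _; rewrite /= mxE mulrA. Qed.

Lemma dotDr u v w : dot u (v + w) = dot u v + dot u w.
Proof. by rewrite !(dotC u) dotDl. Qed.

Lemma dotZr a u w : dot u (a *: w) = a * dot u w.
Proof. by rewrite !(dotC u) dotZl. Qed.

Lemma dotNl u w : dot (- u) w = - dot u w.
Proof. by rewrite -scaleN1r dotZl mulN1r. Qed.

Lemma dotNr u w : dot u (- w) = - dot u w.
Proof. by rewrite -scaleN1r dotZr mulN1r. Qed.

Lemma dot0l u : dot 0 u = 0.
Proof. by rewrite -(scale0r 0) dotZl mul0r. Qed.

Lemma dot0r u : dot u 0 = 0.
Proof. by rewrite dotC dot0l. Qed.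

Lemma dot_suml (I : Type) (r : seq I) (P : pred I) (f : I -> 'rV[R]_m) w :
  dot (\sum_(i <- r | P i) f i) w = \sum_(i <- r | P i) dot (f i) w.
Proof.
apply: (big_morph (fun u => dot u w)) => [u v|]; [exact: dotDl|exact: dot0l].
Qed.

Lemma dot_sumr (I : Type) (r : seq I) (P : pred I) (f : I -> 'rV[R]_m) w :
  dot w (\sum_(i <- r | P i) f i) = \sum_(i <- r | P i) dot w (f i).
Proof. by rewrite dotC dot_suml; apply: eq_bigr => i _; exact: dotC. Qed.

Lemma dot_delta u k : dot (delta_mx 0 k) u = u 0 k.
Proof.
rewrite /dot (bigD1 k)//= mxE !eqxx mul1r big1 ?addr0// => i ik.
by rewrite mxE (negPf ik) andbF mul0r.
Qed.

Lemma dot_ge0 u : 0 <= dot u u.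
Proof. by apply: sumr_ge0 => i _; rewrite -expr2 sqr_ge0. Qed.

Lemma dot_eq0 u : (dot u u == 0) = (u == 0).
Proof.
apply/idP/eqP => [|->]; last by rewrite dot0l.
rewrite psumr_eq0 => [/allP u0|i _]; last by rewrite -expr2 sqr_ge0.
apply/rowP => i; rewrite mxE; apply/eqP.
by have := u0 i (mem_index_enum _); rewrite mulf_eq0 orbb.
Qed.

Lemma dot_mulmx u v : dot u v = (u *m v^T) 0 0.
Proof. by rewrite mxE; apply: eq_bigr => i _; rewrite mxE. Qed.

Definition dotE := (dotDl, dotDr, dotNl, dotNr, dotZl, dotZr).

(* Cauchy-Schwarz for a unit vector, from |u - <u,v> v|^2 >= 0. *)
Lemma dot_unit_le u v : dot v v = 1 -> dot u v ^+ 2 <= dot u u.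
Proof.
move=> v1; have := dot_ge0 (u - dot u v *: v).
rewrite !dotE v1 (dotC v u) => uv0; rewrite -subr_ge0.
by apply: le_trans uv0 _; rewrite le_eqVlt; apply/orP; left; apply/eqP; ring.
Qed.

Lemma sum_mul_coord u v : \sum_k u 0 k * v 0 k = dot u v.
Proof. by []. Qed.

Lemma row_sum_coord u : \sum_k u 0 k *: delta_mx 0 k = u.
Proof. by rewrite -row_sum_delta. Qed.

End Dot.

(* A spatial critical point (x, y) of the two-point function Z, in terms of
   ambient vectors: JF and JN are the Jacobians of the immersion F and of its
   normal N at x, JQ that of the second copy Q at y, whose normal is M; D is
   Q(y) - F(x) and G is the time derivative of N, that is, grad H.  The vectors
   a k and b k lift the tangential parts of the k-th ambient basis vector at x and
   at y, and Fkk, Nkk, Qkk, Hkk are second derivatives along them. *)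
Section CriticalPoint.
Variables (R : realType) (n m : nat).
Variables (JF JN JQ : 'M[R]_(n, m)) (a b : 'I_m -> 'rV[R]_n).
Variables (D N M G : 'rV[R]_m) (H H' delta Ht : R).
Variables (Fkk Nkk Qkk : 'I_m -> 'rV[R]_m) (Hkk : 'I_m -> R).

Hypothesis N1 : dot N N = 1.
Hypothesis M1 : dot M M = 1.
Hypothesis FN : forall c, dot (c *m JF) N = 0.
Hypothesis NN : forall c, dot (c *m JN) N = 0.
Hypothesis GN : dot G N = 0.
Hypothesis FNC : forall c d, dot (c *m JF) (d *m JN) = dot (d *m JF) (c *m JN).
Hypothesis aE : forall k, a k *m JF = delta_mx 0 k - N 0 k *: N.
Hypothesis bE : forall k, b k *m JQ = delta_mx 0 k - M 0 k *: M.
Hypothesis FkkN : \sum_k dot (Fkk k) N = - H.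
Hypothesis QkkM : \sum_k dot (Qkk k) M = - H'.
Hypothesis NkkN : forall k, dot (Nkk k) N = - dot (a k *m JN) (a k *m JN).
Hypothesis codazzi : forall c,
  dot (c *m JF) G = \sum_k (dot (c *m JF) (Nkk k) - dot (Fkk k) (c *m JN)).
Hypothesis evolution : Ht = \sum_k (Hkk k - dot (Fkk k) G
  + H * dot (a k *m JN) (a k *m JN)).
Hypothesis crity : forall c, dot (c *m JQ) (H *: D + delta *: N) = 0.
Hypothesis critx : forall c, dot (c *m JF) G * dot D D / 2 - H * dot D (c *m JF)
  + delta * dot D (c *m JN) = 0.
Hypothesis hess_ge0 : 0 <= \sum_k
  (Hkk k / 2 * dot D D
   + 2 * dot (a k *m JF) G * dot D (b k *m JQ - a k *m JF)
   + H * (dot (b k *m JQ - a k *m JF) (b k *m JQ - a k *m JF)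
          + dot D (Qkk k - Fkk k))
   + delta * (dot (Qkk k - Fkk k) N
              + 2 * dot (b k *m JQ - a k *m JF) (a k *m JN)
              + dot D (Nkk k))).

Let rho := dot (H *: D + delta *: N) M.
Let A2 := \sum_k dot (a k *m JN) (a k *m JN).
Let Z := H / 2 * dot D D + delta * dot D N.
(** Time derivative of [Z] under the flow: [H *: N - H' *: M] is the velocity of [D], and [Ht] and
    [G] are those of [H] and [N]. *)
Let Zt := Ht / 2 * dot D D + H * dot D (H *: N - H' *: M)
  + delta * dot (H *: N - H' *: M) N + delta * dot D G.

(** By [crity] the left side is orthogonal to the tangent space at [y], hence normal there; testing
    against [b k] gives the k-th coordinate. *)
Let rhoM : H *: D + delta *: N = rho *: M.
Proof.
apply/rowP => k; have := crity (b k).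
rewrite bE !dotE !dot_delta !mxE /rho !dotE (dotC D M) (dotC N M) => e.
by apply/eqP; rewrite -subr_eq0 -[X in _ == X]e; apply/eqP; ring.
Qed.

Lemma critical_point_rho : rho ^+ 2 = delta ^+ 2 + 2 * H * Z.
Proof.
have -> : rho ^+ 2 = dot (rho *: M) (rho *: M) by rewrite !dotE M1 mulr1.
rewrite -rhoM /Z !dotE N1 (dotC N D); by field.
Qed.

Hypothesis rho_neq0 : rho != 0.

Let sumF := \sum_k Fkk k.
Let sumQ := \sum_k Qkk k.
Let sumN := \sum_k Nkk k.

Let lift_tangent (JX : 'M[R]_(n, m)) (x : 'I_m -> 'rV[R]_n) (X u : 'rV[R]_m) :
  (forall k, x k *m JX = delta_mx 0 k - X 0 k *: X) -> dot u X = 0 ->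
  (\sum_k u 0 k *: x k) *m JX = u.
Proof.
move=> xE uX; rewrite mulmx_suml.
under eq_bigr do rewrite -scalemxAl xE scalerBr scalerA.
rewrite sumrB row_sum_coord -scaler_suml.
by rewrite -[X in X *: _]/(dot u X) uX scale0r subr0.
Qed.

(** Chart coordinates of the tangential part of [sumF]. This is the first-order term by which the
    traced coordinate second derivatives differ from the Laplacian; [beta] is its analogue at
    [y]. *)
Let alpha := \sum_k (sumF + H *: N) 0 k *: a k.
Let beta := \sum_k (sumQ + H' *: M) 0 k *: b k.

Let alphaE : alpha *m JF = sumF + H *: N.
Proof.
by apply: lift_tangent aE _; rewrite !dotE N1 dot_suml FkkN mulr1 addNr.
Qed.

Let betaE : beta *m JQ = sumQ + H' *: M.
Proof.
by apply: lift_tangent bE _; rewrite !dotE M1 dot_suml QkkM mulr1 addNr.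
Qed.

(** The identity Lap N = grad H - |A|^2 N, up to the chart term in [alpha]. The tangential part
    comes from [codazzi], the normal part from [NkkN]. *)
Let sumNE : sumN = G + alpha *m JN - A2 *: N.
Proof.
apply/rowP => k; rewrite -!dot_delta.
have -> : delta_mx 0 k = a k *m JF + N 0 k *: N by rewrite aE subrK.
rewrite !dotE (dotC N sumN) dot_suml; under eq_bigr do rewrite NkkN.
rewrite sumrN -/A2 (dotC N G) GN (dotC N (_ *m _)) NN N1 FN.
rewrite (codazzi (a k)) sumrB -dot_sumr -/sumN -dot_suml -/sumF.
have -> : sumF = alpha *m JF - H *: N by rewrite alphaE addrK.
rewrite !dotE (dotC N (_ *m _)) NN (FNC alpha); ring.
Qed.

Let HkkE : \sum_k Hkk k = Ht + dot sumF G - H * A2.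
Proof.
rewrite evolution big_split/= sumrB -dot_suml -/sumF -mulr_sumr -/A2; ring.
Qed.

(** The reason for pairing directions through one ambient basis vector: that vector cancels, only
    the normals remain, and all cross terms sum in closed form. *)
Let diffE k : b k *m JQ - a k *m JF = N 0 k *: N - M 0 k *: M.
Proof. by rewrite aE bE opprB addrC addrA addrNK addrC. Qed.

(** Lift of the tangential part at [x] of the normal at [y]. Criticality in this direction turns the
    remainder [E] into a multiple of [Z]. *)
Let mm := \sum_k M 0 k *: a k.

Let mmE : mm *m JF = M - dot M N *: N.
Proof.
rewrite mulmx_suml.
under eq_bigr do rewrite -scalemxAl aE scalerBr scalerA.
by rewrite sumrB row_sum_coord -scaler_suml.
Qed.

Let E := - 2 * dot G M * dot D M + 2 * H * (1 - dot M N ^+ 2)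
  - 2 * delta * dot M (mm *m JN).

Let sum_diff2 : \sum_k dot (N 0 k *: N - M 0 k *: M) (N 0 k *: N - M 0 k *: M)
  = 2 * (1 - dot M N ^+ 2).
Proof.
under eq_bigr => k _.
  rewrite !dotE N1 M1 (dotC N M).
  have -> : N 0 k * (N 0 k * 1 - M 0 k * dot M N) +
    (N 0 k * - (M 0 k * dot M N) - M 0 k * - (M 0 k * 1)) =
    N 0 k * N 0 k + M 0 k * M 0 k - 2 * dot M N * (M 0 k * N 0 k) by ring.
  over.
rewrite sumrB big_split/= -mulr_sumr !sum_mul_coord N1 M1; ring.
Qed.

Let sum_diffG : \sum_k dot (a k *m JF) G * dot D (N 0 k *: N - M 0 k *: M)
  = - dot G M * dot D M.
Proof.
under eq_bigr => k _.
  rewrite aE !dotE dot_delta (dotC N G) GN mulr0 subr0.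
  have -> : G 0 k * (N 0 k * dot D N - M 0 k * dot D M) =
    dot D N * (G 0 k * N 0 k) - dot D M * (G 0 k * M 0 k) by ring.
  over.
rewrite sumrB -!mulr_sumr !sum_mul_coord GN; ring.
Qed.

Let sum_diffN : \sum_k dot (N 0 k *: N - M 0 k *: M) (a k *m JN)
  = - dot M (mm *m JN).
Proof.
under eq_bigr do rewrite !dotE (dotC N) NN mulr0 sub0r.
rewrite sumrN mulmx_suml dot_sumr; congr (- _).
by apply: eq_bigr => k _; rewrite -scalemxAl dotZr.
Qed.

Let hessE : \sum_k
  (Hkk k / 2 * dot D D
   + 2 * dot (a k *m JF) G * dot D (b k *m JQ - a k *m JF)
   + H * (dot (b k *m JQ - a k *m JF) (b k *m JQ - a k *m JF)
          + dot D (Qkk k - Fkk k))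
   + delta * (dot (Qkk k - Fkk k) N
              + 2 * dot (b k *m JQ - a k *m JF) (a k *m JN)
              + dot D (Nkk k))) = Zt - A2 * Z + E.
Proof.
under eq_bigr => k _.
  rewrite !diffE.
  have -> : forall x1 x2 x3 x4 x5 x6 x7 x8 x9 : R,
    x1 / 2 * x2 + 2 * x3 * x4 + H * (x5 + x6) + delta * (x7 + 2 * x8 + x9) =
    x1 * (x2 / 2) + 2 * (x3 * x4) + H * x5 + H * x6 + delta * x7 +
     (2 * delta) * x8 + delta * x9 by move=> *; ring.
  over.
rewrite !big_split/= -!mulr_sumr -mulr_suml sum_diffG sum_diff2 sum_diffN.
rewrite -dot_sumr -dot_suml -dot_sumr sumrB -/sumF -/sumQ -/sumN HkkE sumNE.
have -> : sumF = alpha *m JF - H *: N by rewrite alphaE addrK.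
have -> : sumQ = beta *m JQ - H' *: M by rewrite betaE addrK.
(* The chart terms that remain are the derivatives of [Z] along [alpha] at [x] and along [beta] at
   [y]. *)
have := critx alpha; have := crity beta.
rewrite /E /Zt /Z !dotE (dotC N G) GN FN N1 (dotC (_ *m JQ) D).
rewrite ?(dotC N M).
rewrite (dotC D (alpha *m JF)) (dotC D (alpha *m JN)).
move: (dot (alpha *m JF) G) (dot (alpha *m JF) D) (dot (alpha *m JN) D) => xa xb xc.
move: (dot D (beta *m JQ)) (dot (beta *m JQ) N) => xd xe.
lra.
Qed.

(** The traced Hessian is [Zt - A2 * Z + E], so the claim follows from
    [rho * E = - 2 * dot G M * Z]. *)
Lemma critical_point_inequality : (A2 + 2 * dot G M / rho) * Z <= Zt.
Proof.
have EE : E = - (2 * dot G M / rho) * Z.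
  have DM : rho * dot D M = H * dot D D + delta * dot D N.
    by rewrite -dotZr -rhoM !dotE.
  have rhoN : rho * dot M N = H * dot D N + delta.
    by rewrite -dotZl -rhoM !dotE N1 mulr1.
  (* Criticality at [x] along [mm], multiplied by [H]. By [rhoM], [H * dot D v] becomes
     [rho * dot M v] for the two vectors [v] involved, both orthogonal to [N]. *)
  have mmX : H * (dot G M * dot D D / 2) =
      rho * (H * (1 - dot M N ^+ 2) - delta * dot M (mm *m JN)).
    have HD x : H * dot D x = rho * dot M x - delta * dot N x.
      by rewrite -!dotZl -rhoM dotDl addrK.
    have := critx mm; have := HD (mm *m JF); have := HD (mm *m JN).
    rewrite (dotC N (_ *m JN)) NN (dotC N (_ *m JF)) FN mmE !dotE M1 (dotC N G) GN.
    rewrite (dotC M G) => e1 e2 e3; move: e2 e3.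
    set y1 := dot D (mm *m JN) in e1 *; set y2 := dot M (mm *m JN) in e1 *.
    move=> e2 e3.
    have : H * (dot G M * dot D D / 2) - H * (H * (dot D M - dot M N * dot D N))
      + delta * (H * y1) = 0 by rewrite -[RHS](mulr0 H) -[in RHS]e3; ring.
    rewrite e1 => e4; have e5 : H * (dot D M - dot M N * dot D N) =
       rho * (1 - dot M N ^+ 2) by rewrite -[LHS]/(H * (dot D M - dot M N * dot D N)) e2; ring.
    rewrite e5 in e4; lra.
  apply: (mulfI rho_neq0).
  have -> : rho * (- (2 * dot G M / rho) * Z) = - 2 * dot G M * Z by field.
  have -> : rho * E = - 2 * dot G M * (rho * dot D M) + 2 *
     (rho * (H * (1 - dot M N ^+ 2) - delta * dot M (mm *m JN))).
    by rewrite /E; ring.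
  by rewrite -mmX DM /Z; field.
move: hess_ge0; rewrite hessE EE; lra.
Qed.

End CriticalPoint.

(** * Local geometry of hypersurfaces *)

(* Locked because unification otherwise unfolds nested derivatives. *)
HB.lock Definition vderive (R : realType) (V : normedModType R) (m : nat) (v : V)
    (F : V -> 'rV[R]_m) (x : V) : 'rV[R]_m :=
  \row_i 'D_v (fun y => F y 0 i) x.
Canonical vderive_unlockable := Unlockable vderive.unlock.

(** * Derivatives of vector-valued and matrix-valued functions *)

Section VectorCalculus.
Variables (R : realType) (V : normedModType R).
Implicit Types (U : set V) (v w x z : V).
Local Notation smooth := smooth_on_open.

Lemma derive_near U (W : normedModType R) (f g : V -> W) v x : open U -> U x ->
  (forall y, U y -> f y = g y) -> 'D_v f x = 'D_v g x.
Proof.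
move=> oU Ux fg; apply: near_eq_derive.
by apply: filterS (open_nbhs_nbhs (conj oU Ux)) => y; exact: fg.
Qed.

Lemma derive_add U (f g : V -> R) v x : smooth U f -> smooth U g -> U x ->
  'D_v (fun y => f y + g y) x = 'D_v f x + 'D_v g x.
Proof.
by move=> sf sg Ux; rewrite -deriveD//; apply: smooth_derivable Ux.
Qed.

Lemma derive_mul U (f g : V -> R) v x : smooth U f -> smooth U g -> U x ->
  'D_v (fun y => f y * g y) x = 'D_v f x * g x + f x * 'D_v g x.
Proof.
move=> sf sg Ux.
have df : derivable f x v by exact: smooth_derivable Ux.
have dg : derivable g x v by exact: smooth_derivable Ux.
by rewrite (deriveM df dg) addrC mulrC.
Qed.

Lemma derive_opp U (f : V -> R) v x : smooth U f -> U x ->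
  'D_v (fun y => - f y) x = - 'D_v f x.
Proof. by move=> sf Ux; rewrite -deriveN//; exact: smooth_derivable Ux. Qed.

Lemma derive_bigsum U (I : Type) (r : seq I) (f : I -> V -> R) v x :
  open U -> (forall i, smooth U (f i)) -> U x ->
  'D_v (fun y => \sum_(i <- r) f i y) x = \sum_(i <- r) 'D_v (f i) x.
Proof.
move=> oU sf Ux; elim: r => [|i r IH].
  by under eq_fun do rewrite big_nil; rewrite big_nil derive_cst.
under eq_fun do rewrite big_cons.
rewrite big_cons -IH; apply: derive_add Ux => //; exact: smooth_sum.
Qed.

Variable m : nat.
Implicit Types (F G : V -> 'rV[R]_m).

Definition vsmooth U F := forall i, smooth U (fun x => F x 0 i).

Lemma vderiveE v F x i : vderive v F x 0 i = 'D_v (fun y => F y 0 i) x.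
Proof. by rewrite unlock mxE. Qed.

Lemma vsmooth_smooth U F : open U -> smooth U F -> vsmooth U F.
Proof. by move=> oU sF i; exact: smooth_coord. Qed.

Lemma derive_vderive v F x : differentiable F x -> 'D_v F x = vderive v F x.
Proof.
move=> dF; rewrite derive_mx; last exact: diff_derivable.
by apply/rowP => i; rewrite vderiveE mxE.
Qed.

Lemma vsmooth_subset U U' F : U' `<=` U -> vsmooth U F -> vsmooth U' F.
Proof. by move=> sU sF i; exact: smooth_subset sU (sF i). Qed.

Lemma vsmooth_vderive U v F : vsmooth U F -> vsmooth U (vderive v F).
Proof.
move=> sF i; under eq_fun do rewrite vderiveE.
exact: smooth_derive.
Qed.

Lemma vderive_near U F G v x : open U -> U x ->
  (forall y, U y -> F y = G y) -> vderive v F x = vderive v G x.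
Proof.
move=> oU Ux FG; apply/rowP => i; rewrite !vderiveE.
by apply: (derive_near _ oU) => // y Uy; rewrite FG.
Qed.

Lemma vderive_comm U F v w x : open U -> vsmooth U F -> U x ->
  vderive v (vderive w F) x = vderive w (vderive v F) x.
Proof.
move=> oU sF Ux; apply/rowP => i; rewrite !vderiveE.
under eq_fun do rewrite vderiveE; under [in RHS]eq_fun do rewrite vderiveE.
exact: derive_comm (sF i) Ux.
Qed.

Lemma vsmoothZ U (h : V -> R) F : open U -> smooth U h -> vsmooth U F ->
  vsmooth U (fun x => h x *: F x).
Proof.
move=> oU sh sF i; under eq_fun do rewrite mxE; exact: smoothM.
Qed.

Lemma vderiveZ U (h : V -> R) F v x : smooth U h -> vsmooth U F -> U x ->
  vderive v (fun x => h x *: F x) x = 'D_v h x *: F x + h x *: vderive v F x.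
Proof.
move=> sh sF Ux; apply/rowP => i; rewrite !mxE !vderiveE.
under eq_fun do rewrite mxE.
by rewrite (derive_mul _ sh (sF i) Ux).
Qed.

Lemma smooth_dot U F G : open U -> vsmooth U F -> vsmooth U G ->
  smooth U (fun x => dot (F x) (G x)).
Proof.
by move=> oU sF sG; apply: smooth_sum => // i; exact: smoothM.
Qed.

Lemma derive_dot U F G v x : open U -> vsmooth U F -> vsmooth U G -> U x ->
  'D_v (fun y => dot (F y) (G y)) x
  = dot (vderive v F x) (G x) + dot (F x) (vderive v G x).
Proof.
move=> oU sF sG Ux; rewrite (derive_bigsum _ _ oU)//; last first.
  by move=> i; exact: smoothM.
rewrite -big_split; apply: eq_bigr => i _ /=.
by rewrite !vderiveE (derive_mul _ (sF i) (sG i) Ux).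
Qed.

Definition msmooth p q U (A : V -> 'M[R]_(p, q)) :=
  forall i j, smooth U (fun x => A x i j).

Lemma msmooth_mul p q r U (A : V -> 'M[R]_(p, q)) (B : V -> 'M[R]_(q, r)) :
  open U -> msmooth U A -> msmooth U B -> msmooth U (fun x => A x *m B x).
Proof.
move=> oU sA sB i j; under eq_fun do rewrite mxE.
by apply: smooth_sum => // k; exact: smoothM.
Qed.

Lemma smooth_det p U (A : V -> 'M[R]_p) : open U -> msmooth U A ->
  smooth U (fun x => \det (A x)).
Proof.
move=> oU sA; apply: smooth_sum => // s; apply: smoothM => //.
  exact: smooth_cst.
by apply: smooth_prod => // i; exact: sA.
Qed.

(** As [f] may be negative, its inverse is written as [f] times the power -1 of the positive
    function [f * f]. *)
Lemma smoothV U (f : V -> R) : open U -> (forall x, U x -> f x != 0) ->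
  smooth U f -> smooth U (fun x => (f x)^-1).
Proof.
move=> oU f0 sf.
apply: (smooth_congr oU (f := fun x => f x * (f x * f x) `^ (-1))) => [x Ux|].
  have fx0 := f0 x Ux.
  by rewrite powR_inv1 -?expr2 ?sqr_ge0// expr2 invfM mulrA divff// mul1r.
apply: smoothM => //; apply: smooth_powR => //; last exact: smoothM.
by move=> x Ux; rewrite -expr2 exprn_even_gt0//= f0.
Qed.

(** Cramer's rule: entries of the inverse are cofactors divided by the determinant. *)
Lemma msmooth_invmx p U (A : V -> 'M[R]_p) : open U ->
  (forall x, U x -> A x \in unitmx) -> msmooth U A ->
  msmooth U (fun x => invmx (A x)).
Proof.
move=> oU uA sA i j.
apply: (smooth_congr oU (f := fun x => (\det (A x))^-1 *
  ((-1) ^+ (j + i) * \det (row' j (col' i (A x)))))) => [x Ux|].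
  by rewrite /invmx uA// !mxE.
apply: smoothM => //.
  apply: smoothV => //; last exact: smooth_det.
  by move=> x Ux; rewrite -unitfE -unitmxE uA.
apply: smoothM => //; first exact: smooth_cst.
by apply: smooth_det => // k l; under eq_fun do rewrite !mxE; exact: sA.
Qed.

End VectorCalculus.

(** * Tangential projection through a pseudo-inverse *)

Section TangentialInverse.
Variables (R : realType) (n : nat).

(** The Moore-Penrose inverse of a Jacobian of full rank. Its rows lift the tangential projections
    of the ambient basis vectors by a formula that is smooth in [J]. *)
Definition tangent_pinv (J : 'M[R]_(n, n.+1)) : 'M[R]_(n.+1, n) :=
  J^T *m invmx (J *m J^T).

Variables (J : 'M[R]_(n, n.+1)) (N : 'rV[R]_n.+1).
Hypothesis J_inj : forall c : 'rV[R]_n, c *m J = 0 -> c = 0.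
Hypothesis N1 : dot N N = 1.
Hypothesis JN : forall c : 'rV[R]_n, dot (c *m J) N = 0.

Lemma gram_unit : J *m J^T \in unitmx.
Proof.
rewrite -row_free_unit; apply: inj_row_free => v vg.
apply: J_inj; apply/eqP; rewrite -dot_eq0 dot_mulmx.
by rewrite trmx_mul mulmxA -(mulmxA v) vg mul0mx mxE.
Qed.

Let JNT : J *m N^T = 0.
Proof.
apply/matrixP => i j; rewrite ord1 [RHS]mxE.
by rewrite -[RHS](JN (delta_mx 0 i)) -rowE dot_mulmx -row_mul [in RHS]mxE.
Qed.

Let NJT : N *m J^T = 0.
Proof. by rewrite -[LHS]trmxK trmx_mul trmxK JNT trmx0. Qed.

(** Both sides agree after left multiplication by [J] stacked on [N], a square matrix of full rank
    because [N] is orthogonal to the independent rows of [J]. *)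
Lemma tangent_pinv_mul : tangent_pinv J *m J = 1%:M - N^T *m N.
Proof.
set P := tangent_pinv J *m J.
have NN : N *m N^T = 1%:M.
  by apply/matrixP => i j; rewrite !ord1 -dot_mulmx N1// mxE eqxx.
pose A := col_mx J N.
have fA : row_full A.
  have : row_free A.
    apply: inj_row_free => v; rewrite -[v]hsubmxK /A mul_row_col => vA.
    have v2 : rsubmx v = 0.
      have : (lsubmx v *m J + rsubmx v *m N) *m N^T = 0 by rewrite vA mul0mx.
      by rewrite mulmxDl -!mulmxA JNT NN mulmx0 add0r mulmx1.
    have v1 : lsubmx v = 0 by apply: J_inj; rewrite v2 mul0mx addr0 in vA.
    by rewrite v1 v2 row_mx0.
  by rewrite /row_full /row_free => /eqP ->; rewrite addn1.
apply: (row_full_inj fA).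
rewrite !mul_col_mx !mulmxBr !mulmx1 !mulmxA NN mul1mx subrr JNT mul0mx subr0.
rewrite /P /tangent_pinv ?mulmxA NJT !mul0mx; congr col_mx.
by rewrite mulmxV ?mul1mx//; exact: gram_unit.
Qed.

Lemma row_tangent_pinv k :
  row k (tangent_pinv J) *m J = delta_mx 0 k - N 0 k *: N.
Proof.
rewrite -row_mul tangent_pinv_mul.
apply/rowP => j; rewrite !mxE big_ord_recl big_ord0 addr0 !mxE.
by rewrite eq_sym.
Qed.

Lemma normal_tangent_pinv : N *m tangent_pinv J = 0.
Proof. by rewrite /tangent_pinv mulmxA NJT mul0mx. Qed.

End TangentialInverse.

(** * Codazzi and evolution equations in the projected frame *)

Section LocalGeometry.
Variables (R : realType) (n : nat).
Local Notation E := ('rV[R]_n * R)%type.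
Variable U : set E.
Local Notation dx c := ((c : 'rV[R]_n), (0 : R)).
Local Notation dt := ((0 : 'rV[R]_n), (1 : R)).

Definition jac m (G : E -> 'rV[R]_m) (z : E) : 'M[R]_(n, m) :=
  \matrix_i vderive (dx (delta_mx 0 i)) G z.

Lemma jacE m (G : E -> 'rV[R]_m) z i j :
  jac G z i j = 'D_(dx (delta_mx 0 i)) (fun y => G y 0 j) z.
Proof. by rewrite mxE vderiveE. Qed.

Hypothesis oU : open U.

Lemma derive_dx (f : E -> R) c z : smooth_on_open U f -> U z ->
  'D_(dx c) f z = \sum_i c 0 i * 'D_(dx (delta_mx 0 i)) f z.
Proof.
move=> sf Uz; have df := smooth_differentiable sf Uz.
rewrite deriveE//.
have -> : dx c = \sum_i c 0 i *: dx (delta_mx 0 i).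
  rewrite [LHS]surjective_pairing [RHS]surjective_pairing/=; congr pair.
    rewrite (big_morph fst (id1 := 0) (op1 := +%R))//= -[LHS]row_sum_coord.
    exact: eq_bigr.
  rewrite (big_morph snd (id1 := 0) (op1 := +%R))//= big1// => i _.
  by rewrite scaler0.
by rewrite linear_sum; apply: eq_bigr => i _; rewrite linearZ deriveE.
Qed.

Lemma vderive_dx m (G : E -> 'rV[R]_m) c z : vsmooth U G -> U z ->
  vderive (dx c) G z = c *m jac G z.
Proof.
move=> sG Uz; apply/rowP => j; rewrite vderiveE (derive_dx _ (sG j) Uz) mxE.
by apply: eq_bigr => i _; rewrite jacE.
Qed.

Lemma msmooth_jac m (G : E -> 'rV[R]_m) : vsmooth U G -> msmooth U (jac G).
Proof.
move=> sG i j; under eq_fun do rewrite jacE.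
exact: smooth_derive.
Qed.

Definition frame (F : E -> 'rV[R]_n.+1) z : 'M[R]_(n.+1, n) :=
  tangent_pinv (jac F z).

Lemma msmooth_frame (F : E -> 'rV[R]_n.+1) : vsmooth U F ->
  (forall z, U z -> jac F z *m (jac F z)^T \in unitmx) -> msmooth U (frame F).
Proof.
move=> sF uF; have sJ := msmooth_jac sF.
have sJT : msmooth U (fun z => (jac F z)^T).
  by move=> i j; under eq_fun do rewrite mxE; exact: sJ.
by apply: msmooth_mul => //; apply: msmooth_invmx => //; exact: msmooth_mul.
Qed.

Variables (F N : E -> 'rV[R]_n.+1).
Hypothesis sF : vsmooth U F.
Hypothesis sN : vsmooth U N.
Hypothesis N1 : forall z, U z -> dot (N z) (N z) = 1.
Hypothesis FN : forall z c, U z -> dot (vderive (dx c) F z) (N z) = 0.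
Hypothesis imm : forall z c, U z -> vderive (dx c) F z = 0 -> c = 0.

Let jac_inj z (c : 'rV[R]_n) : U z -> c *m jac F z = 0 -> c = 0.
Proof. by move=> Uz; rewrite -vderive_dx//; exact: imm. Qed.

Let jac_normal z (c : 'rV[R]_n) : U z -> dot (c *m jac F z) (N z) = 0.
Proof. by move=> Uz; rewrite -vderive_dx// FN. Qed.

Lemma frameE z k : U z -> vderive (dx (row k (frame F z))) F z
  = delta_mx 0 k - N z 0 k *: N z.
Proof.
move=> Uz; rewrite vderive_dx//; apply: row_tangent_pinv; last first.
- by move=> c; exact: jac_normal.
- exact: N1.
- by move=> c; exact: jac_inj.
Qed.

Lemma normal_frame z : U z -> N z *m frame F z = 0.
Proof. by move=> Uz; apply: normal_tangent_pinv => c; exact: jac_normal. Qed.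

Let msmooth_frame : msmooth U (frame F).
Proof.
by apply: msmooth_frame => // z Uz; apply: gram_unit => c; exact: jac_inj.
Qed.

(** The frame moves with the point: the product rule separates the derivative of its coefficients
    from the second derivative along the frame frozen at [z]. *)
Lemma derive_frame_sum (G : E -> 'rV[R]_n.+1) k j xi z : vsmooth U G -> U z ->
  'D_xi (fun y => \sum_i frame F y k i * vderive (dx (delta_mx 0 i)) G y 0 j) z
  = vderive (dx (\row_i 'D_xi (fun y => frame F y k i) z)) G z 0 j
    + vderive xi (vderive (dx (row k (frame F z))) G) z 0 j.
Proof.
move=> sG Uz.
have sGi i : vsmooth U (vderive (dx (delta_mx 0 i)) G) by exact: vsmooth_vderive.
rewrite (derive_bigsum _ _ oU)//; last first.
  by move=> i; apply: smoothM => //; exact: sGi.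
rewrite (vderive_comm _ _ oU)// !vderive_dx//; last exact: vsmooth_vderive.
rewrite !mxE -big_split; apply: eq_bigr => i _ /=.
rewrite (derive_mul _ (msmooth_frame k i) (sGi i j) Uz) !jacE vderiveE.
congr (_ * _ + _ * _); first by rewrite mxE.
  by rewrite [RHS]mxE.
under eq_fun do rewrite vderiveE; under [in RHS]eq_fun do rewrite vderiveE.
exact: (derive_comm _ _ oU (sG j) Uz).
Qed.

Variable H : E -> R.
Hypothesis sH : smooth_on_open U H.
Hypothesis Ft : forall z, U z -> vderive dt F z = - H z *: N z.
Hypothesis Hdiv : forall z, U z -> forall a : 'I_n.+1 -> 'rV[R]_n,
  (forall k, vderive (dx (a k)) F z = delta_mx 0 k - N z 0 k *: N z) ->
  H z = \sum_k vderive (dx (a k)) N z 0 k.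

Lemma dot_vderive_normal xi z : U z -> dot (vderive xi N z) (N z) = 0.
Proof.
move=> Uz.
have : 'D_xi (fun y => dot (N y) (N y)) z = 0.
  by rewrite (derive_near _ oU Uz N1) derive_cst.
rewrite (derive_dot _ oU)// (dotC (N z)) -mulr2n => /eqP.
by rewrite mulrn_eq0/= => /eqP.
Qed.

Lemma dot_vderive_dx_normal c xi z : U z ->
  dot (vderive (dx c) F z) (vderive xi N z)
  = - dot (vderive xi (vderive (dx c) F) z) (N z).
Proof.
move=> Uz; apply/eqP; rewrite -addr_eq0 addrC -(derive_dot _ oU)//; last first.
  exact: vsmooth_vderive.
by rewrite (derive_near _ oU Uz (fun y Uy => FN c Uy)) derive_cst.
Qed.

Lemma weingarten_sym c d z : U z ->
  dot (vderive (dx c) F z) (vderive (dx d) N z)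
  = dot (vderive (dx d) F z) (vderive (dx c) N z).
Proof.
move=> Uz; rewrite (dot_vderive_dx_normal c _ Uz) (dot_vderive_dx_normal d _ Uz).
by rewrite (vderive_comm _ _ oU sF Uz).
Qed.

Lemma dot_vderive2_normal xi z : U z ->
  dot (vderive xi (vderive xi N) z) (N z) = - dot (vderive xi N z) (vderive xi N z).
Proof.
move=> Uz; apply/eqP; rewrite -addr_eq0 -(derive_dot _ oU)//; last first.
  exact: vsmooth_vderive.
by rewrite (derive_near _ oU Uz (fun y Uy => dot_vderive_normal xi Uy)) derive_cst.
Qed.

Lemma vderive_comm_normal xi c z : U z ->
  vderive xi (vderive (dx c) N) z = c *m jac (vderive xi N) z.
Proof.
move=> Uz; rewrite (vderive_comm _ _ oU)// vderive_dx//.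
exact: vsmooth_vderive.
Qed.

(** Derivative of the trace of the Weingarten map, with the derivatives of the frame eliminated.
    Spatial [xi] leads to the Codazzi equation, [xi] in the time direction to the evolution of
    [H]. *)
Lemma mean_curvature_derive xi z : U z ->
  'D_xi H z = \sum_k
    (dot (vderive (dx (row k (frame F z))) F z)
         (vderive xi (vderive (dx (row k (frame F z))) N) z)
     - dot (vderive (dx (row k (frame F z))) N z)
           (vderive xi (vderive (dx (row k (frame F z))) F) z)).
Proof.
move=> Uz.
have HE y : U y -> H y =
    \sum_k \sum_i frame F y k i * vderive (dx (delta_mx 0 i)) N y 0 k.
  move=> Uy; rewrite (Hdiv Uy (fun k => frameE k Uy)).
  apply: eq_bigr => k _; rewrite vderive_dx// mxE.
  by apply: eq_bigr => i _; rewrite vderiveE jacE mxE.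
rewrite (derive_near _ oU Uz HE) (derive_bigsum _ _ oU)//; last first.
  move=> k; apply: smooth_sum => // i; apply: smoothM => //.
  exact: vsmooth_vderive.
set a := fun k => row k (frame F z).
set a' := fun k => \row_i 'D_xi (fun y => frame F y k i) z : 'rV[R]_n.
(* The derivative of the frame is known through its image under [F], by differentiating [frameE]. *)
have a'E k : vderive (dx (a' k)) F z = - vderive xi (vderive (dx (a k)) F) z
    - (vderive xi N z 0 k *: N z + N z 0 k *: vderive xi N z).
  apply/rowP => j.
  have := derive_frame_sum k j xi sF Uz.
  have FE y : U y -> \sum_i frame F y k i * vderive (dx (delta_mx 0 i)) F y 0 j
      = (j == k)%:R + - (N y 0 k * N y 0 j).
    move=> Uy; have := frameE k Uy => /(congr1 (fun u : 'rV_n.+1 => u 0 j)).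
    rewrite vderive_dx// mxE !mxE eqxx /= => <-.
    by apply: eq_bigr => i _; rewrite !mxE.
  have sNN := smoothM oU (sN k) (sN j).
  rewrite (derive_near _ oU Uz FE) (derive_add _ (smooth_cst U _) (smoothN oU sNN) Uz).
  rewrite derive_cst add0r (derive_opp _ sNN Uz).
  rewrite (derive_mul _ (sN k) (sN j) Uz) -/(a' k) -/(a k) => e.
  rewrite [LHS]/= -[LHS](addrK (vderive xi (vderive (dx (a k)) F) z 0 j)) -e.
  have mE (u v w : 'rV[R]_n.+1) (b c : R) :
      (- u - (b *: v + c *: w)) 0 j = - u 0 j - (b * v 0 j + c * w 0 j).
    by rewrite !mxE.
  rewrite mE -!vderiveE.
  by move: (vderive _ _ _ 0 j) (vderive _ _ _ 0 k) (vderive _ _ _ 0 j) => x1 x2 x3; ring.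
under eq_bigr => k _.
  rewrite derive_frame_sum// -/(a k) -/(a' k).
  rewrite -(dot_delta (vderive _ N z)) -(dot_delta (vderive _ _ z)).
  have -> : delta_mx 0 k = vderive (dx (a k)) F z + N z 0 k *: N z.
    by rewrite frameE// subrK.
  rewrite !dotDl !dotZl (dotC (N z) (vderive _ N z)) dot_vderive_normal// mulr0 addr0.
  rewrite weingarten_sym// a'E !dotDl !dotNl !dotDl !dotZl.
  rewrite (dotC (N z) (vderive _ N z)) dot_vderive_normal// mulr0 add0r.
  over.
(* The pseudo-inverse kills the normal, so the sums weighted by the coordinates of [N] vanish. *)
have NT : \sum_k N z 0 k *: a k = 0.
  rewrite -[RHS](normal_frame Uz); apply/rowP => i; rewrite summxE !mxE.
  by apply: eq_bigr => k _; rewrite !mxE.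
have S1 : \sum_k N z 0 k * dot (vderive xi N z) (vderive (dx (a k)) N z) = 0.
  under eq_bigr do rewrite -dotZr vderive_dx// scalemxAl.
  by rewrite -dot_sumr -mulmx_suml NT mul0mx dot0r.
have S2 : \sum_k N z 0 k * dot (N z) (vderive xi (vderive (dx (a k)) N) z) = 0.
  under eq_bigr do rewrite -dotZr vderive_comm_normal// scalemxAl.
  by rewrite -dot_sumr -mulmx_suml NT mul0mx dot0r.
apply/eqP; rewrite -subr_eq0 -sumrB; apply/eqP.
transitivity (\sum_k (N z 0 k * dot (N z) (vderive xi (vderive (dx (a k)) N) z)
   - N z 0 k * dot (vderive xi N z) (vderive (dx (a k)) N z))); last first.
  by rewrite sumrB S1 S2 subrr.
apply: eq_bigr => k _; rewrite -/(a k) (dotC (vderive (dx (a k)) N z)).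
by move: (dot _ _) (dot _ _) (dot _ _) (dot _ _) => x1 x2 x3 x4; ring.
Qed.

(** The evolution N_t = grad H of the normal, from differentiating the orthogonality of [N] to the
    tangent vectors in time and inserting [Ft]. *)
Lemma dot_vderive_dt c z : U z ->
  dot (vderive (dx c) F z) (vderive dt N z) = 'D_(dx c) H z.
Proof.
move=> Uz; rewrite dot_vderive_dx_normal// (vderive_comm _ _ oU)//.
have sNH : smooth_on_open U (fun z => - H z) by exact: smoothN.
rewrite (vderive_near _ oU Uz Ft) (vderiveZ _ sNH sN Uz) dotDl !dotZl N1//.
by rewrite dot_vderive_normal// (derive_opp _ sH Uz) mulr1 mulr0 addr0 opprK.
Qed.

(** Third derivatives of [F] commute. [key] differentiates the Weingarten identity once more; its
    instances [k1] and [k2] contain the same third derivative, which cancels between them. *)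
Lemma codazzi c z : U z ->
  'D_(dx c) H z = \sum_k
    (dot (vderive (dx c) F z)
         (vderive (dx (row k (frame F z))) (vderive (dx (row k (frame F z))) N) z)
     - dot (vderive (dx (row k (frame F z))) (vderive (dx (row k (frame F z))) F) z)
           (vderive (dx c) N z)).
Proof.
move=> Uz; rewrite mean_curvature_derive//; apply: eq_bigr => k _.
set a := row k (frame F z).
have sc d : vsmooth U (vderive (dx d) F) by exact: vsmooth_vderive.
have sn d : vsmooth U (vderive (dx d) N) by exact: vsmooth_vderive.
have scc d d' : vsmooth U (vderive (dx d) (vderive (dx d') F)) by exact: vsmooth_vderive.
have key d d' d'' : dot (vderive (dx d'') (vderive (dx d) F) z) (vderive (dx d') N z)
    + dot (vderive (dx d) F z) (vderive (dx d'') (vderive (dx d') N) z)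
  = - (dot (vderive (dx d'') (vderive (dx d') (vderive (dx d) F)) z) (N z)
       + dot (vderive (dx d') (vderive (dx d) F) z) (vderive (dx d'') N z)).
  rewrite -!(derive_dot _ oU)// -(derive_opp _ _ Uz); last exact: smooth_dot.
  by apply: (derive_near _ oU Uz) => y Uy; exact: dot_vderive_dx_normal.
have k1 := key a a c; have k2 := key c a a.
have e1 : vderive (dx c) (vderive (dx a) (vderive (dx a) F)) z =
   vderive (dx a) (vderive (dx a) (vderive (dx c) F)) z.
  rewrite (vderive_comm _ _ oU (sc a) Uz); apply: (vderive_near _ oU Uz) => y Uy.
  exact: (vderive_comm _ _ oU sF Uy).
have e2 : vderive (dx c) (vderive (dx a) F) z = vderive (dx a) (vderive (dx c) F) z.
  exact: (vderive_comm _ _ oU sF Uz).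
rewrite e1 e2 in k1; rewrite e2 (dotC (vderive _ N z)).
have aux (x1 x2 x3 x4 x5 : R) : x1 + x2 = - (x3 + x4) -> x1 + x5 = - (x3 + x1) ->
    x2 - x1 = x5 - x4 by lra.
exact: aux k1 k2.
Qed.

(** This is H_t = Lap H + |A|^2 H. As N_t = grad H, the products with [vderive dt N z] remove the
    first-order chart term from the second derivatives of [H]. *)
Lemma mean_curvature_evolution z : U z ->
  'D_dt H z = \sum_k
    ('D_(dx (row k (frame F z))) ('D_(dx (row k (frame F z))) H) z
     - dot (vderive (dx (row k (frame F z))) (vderive (dx (row k (frame F z))) F) z)
           (vderive dt N z)
     + H z * dot (vderive (dx (row k (frame F z))) N z)
                 (vderive (dx (row k (frame F z))) N z)).
Proof.
move=> Uz; rewrite mean_curvature_derive//; apply: eq_bigr => k _.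
set a := row k (frame F z).
have sc d : vsmooth U (vderive d F) by exact: vsmooth_vderive.
have sn d : vsmooth U (vderive d N) by exact: vsmooth_vderive.
have sNH : smooth_on_open U (fun z => - H z) by exact: smoothN.
have -> : vderive dt (vderive (dx a) F) z =
    - 'D_(dx a) H z *: N z - H z *: vderive (dx a) N z.
  rewrite (vderive_comm _ _ oU)// (vderive_near _ oU Uz Ft) (vderiveZ _ sNH sN Uz).
  by rewrite (derive_opp _ sH Uz) [(- H z) *: _]scaleNr.
have -> : dot (vderive (dx a) F z) (vderive dt (vderive (dx a) N) z) =
  'D_(dx a) ('D_(dx a) H) z - dot (vderive (dx a) (vderive (dx a) F) z) (vderive dt N z).
  apply/eqP; rewrite eq_sym subr_eq addrC (vderive_comm _ _ oU)// -(derive_dot _ oU)//.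
  by apply/eqP; apply: (derive_near _ oU Uz) => y Uy; rewrite dot_vderive_dt.
rewrite !dotE dot_vderive_normal//; ring.
Qed.

Lemma sum_dot_frame z : U z ->
  \sum_k dot (vderive (dx (row k (frame F z))) (vderive (dx (row k (frame F z))) F) z) (N z)
  = - H z.
Proof.
move=> Uz; rewrite (Hdiv Uz (fun k => frameE k Uz)) -sumrN; apply: eq_bigr => k _.
rewrite -[LHS]opprK -dot_vderive_dx_normal// frameE// dotDl dotNl dotZl dot_delta.
by rewrite (dotC (N z)) dot_vderive_normal// mulr0 subr0.
Qed.

End LocalGeometry.

(** * Evolution of the two-point function *)

Definition two_point (R : realType) (m : nat) (delta h : R) (p q nu : 'rV[R]_m) : R :=
  h / 2 * dot (q - p) (q - p) + delta * dot (q - p) nu.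

Section TwoPointDerivative.
Variables (R : realType) (V : normedModType R) (m : nat).
Local Notation smooth := smooth_on_open.

Lemma vderiveB (U : set V) (F G : V -> 'rV[R]_m) v x :
  vsmooth U F -> vsmooth U G -> U x ->
  vderive v (fun y => F y - G y) x = vderive v F x - vderive v G x.
Proof.
move=> sF sG Ux; apply/rowP => i; rewrite !mxE !vderiveE.
under eq_fun do rewrite !mxE.
by rewrite -deriveB//; [exact: smooth_derivable (sF i) Ux|exact: smooth_derivable (sG i) Ux].
Qed.

Lemma vsmoothB (U : set V) (F G : V -> 'rV[R]_m) : open U ->
  vsmooth U F -> vsmooth U G -> vsmooth U (fun y => F y - G y).
Proof.
move=> oU sF sG i; under eq_fun do rewrite !mxE.
exact: smoothB.
Qed.

Lemma vsmooth_line (U : set V) (F : V -> 'rV[R]_m) x v : open U -> vsmooth U F ->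
  vsmooth [set s : R | U (x + s *: v)] (fun s : R => F (x + s *: v)).
Proof. by move=> oU sF i; exact: (smooth_line x v oU (sF i)). Qed.

Lemma vderive_line (F : V -> 'rV[R]_m) x v (s : R) :
  vderive (1 : R) (fun s : R => F (x + s *: v)) s = vderive v F (x + s *: v).
Proof.
apply/rowP => i; rewrite !vderiveE.
exact: (derive_line (fun y => F y 0 i)).
Qed.

Variables (U : set V) (delta : R) (h : V -> R) (d nu : V -> 'rV[R]_m) (v : V).
Hypothesis oU : open U.
Hypothesis sh : smooth U h.
Hypothesis sd : vsmooth U d.
Hypothesis snu : vsmooth U nu.

Let Z y := h y / 2 * dot (d y) (d y) + delta * dot (d y) (nu y).

Lemma smooth_quadratic : smooth U Z.
Proof.
apply: smoothD => //; apply: smoothM => //.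
- by apply: smoothM => //; exact: smooth_cst.
- exact: smooth_dot.
- exact: smooth_cst.
- exact: smooth_dot.
Qed.

Lemma derive_quadratic x : U x -> 'D_v Z x =
  'D_v h x / 2 * dot (d x) (d x) + h x * dot (d x) (vderive v d x)
  + delta * (dot (vderive v d x) (nu x) + dot (d x) (vderive v nu x)).
Proof.
move=> Ux.
have sc c : smooth U (fun=> c : R) by exact: smooth_cst.
have sdd := smooth_dot oU sd sd; have sdn := smooth_dot oU sd snu.
have sh2 := smoothM oU sh (sc 2^-1).
rewrite (derive_add _ (smoothM oU sh2 sdd) (smoothM oU (sc delta) sdn) Ux).
rewrite (derive_mul _ sh2 sdd Ux) (derive_mul _ (sc delta) sdn Ux).
rewrite (derive_mul _ sh (sc _) Ux) !derive_cst.
rewrite (derive_dot _ oU sd sd Ux) (derive_dot _ oU sd snu Ux).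
rewrite (dotC (vderive v d x) (d x)).
move: (dot _ _) (dot _ _) (dot _ _) (dot _ _) (dot _ _) ('D_v h x) => x1 x2 x3 x4 x5 x6.
by field.
Qed.

Lemma derive2_quadratic x : U x -> 'D_v ('D_v Z) x =
  'D_v ('D_v h) x / 2 * dot (d x) (d x) + 2 * 'D_v h x * dot (d x) (vderive v d x)
  + h x * (dot (vderive v d x) (vderive v d x)
           + dot (d x) (vderive v (vderive v d) x))
  + delta * (dot (vderive v (vderive v d) x) (nu x)
             + 2 * dot (vderive v d x) (vderive v nu x)
             + dot (d x) (vderive v (vderive v nu) x)).
Proof.
move=> Ux.
have sc c : smooth U (fun=> c : R) by exact: smooth_cst.
have sd' := vsmooth_vderive v sd; have snu' := vsmooth_vderive v snu.
have sh' := smooth_derive v sh; have sh2 := smoothM oU sh' (sc 2^-1).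
have s1 := smooth_dot oU sd sd; have s2 := smooth_dot oU sd sd'.
have s3 := smooth_dot oU sd' snu; have s4 := smooth_dot oU sd snu'.
rewrite (derive_near _ oU Ux derive_quadratic).
rewrite (derive_add _ (smoothD oU (smoothM oU sh2 s1) (smoothM oU sh s2))
  (smoothM oU (sc delta) (smoothD oU s3 s4)) Ux).
rewrite (derive_add _ (smoothM oU sh2 s1) (smoothM oU sh s2) Ux).
rewrite (derive_mul _ sh2 s1 Ux) (derive_mul _ sh s2 Ux) (derive_mul _ sh' (sc _) Ux).
rewrite (derive_mul _ (sc delta) (smoothD oU s3 s4) Ux) (derive_add _ s3 s4 Ux).
rewrite !derive_cst (derive_dot _ oU sd sd Ux) (derive_dot _ oU sd sd' Ux).
rewrite (derive_dot _ oU sd' snu Ux) (derive_dot _ oU sd snu' Ux).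
rewrite (dotC (vderive v d x) (d x)).
move: (dot _ _) (dot _ _) (dot _ _) (dot _ _) (dot _ _) (dot _ _) (dot _ _) (dot _ _).
move: ('D_v ('D_v h) x) ('D_v h x) => x1 x2 x3 x4 x5 x6 x7 x8 x9 x10.
by field.
Qed.

End TwoPointDerivative.

(** * Criticality and Hessian of Z on a pair of patches *)

Section FlowPatch.
Variables (R : realType) (n : nat).
Local Notation E := ('rV[R]_n * R)%type.
Local Notation dx c := ((c : 'rV[R]_n), (0 : R)).
Local Notation dt := ((0 : 'rV[R]_n), (1 : R)).

(* The last field says that H is the trace of the Weingarten map, computed with
   preimages of the tangential projections of the standard basis of the ambient
   space. *)
Record flow_patch (U : set E) (F N : E -> 'rV[R]_n.+1) (H : E -> R) : Prop := FlowPatch {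
  patch_open : open U;
  patch_F : vsmooth U F;
  patch_N : vsmooth U N;
  patch_H : smooth_on_open U H;
  patch_unit : forall z, U z -> dot (N z) (N z) = 1;
  patch_normal : forall z c, U z -> dot (vderive (dx c) F z) (N z) = 0;
  patch_immersion : forall z c, U z -> vderive (dx c) F z = 0 -> c = 0;
  patch_flow : forall z, U z -> vderive dt F z = - H z *: N z;
  patch_trace : forall z, U z -> forall a : 'I_n.+1 -> 'rV[R]_n,
    (forall k, vderive (dx (a k)) F z = delta_mx 0 k - N z 0 k *: N z) ->
    H z = \sum_k vderive (dx (a k)) N z 0 k
}.

(** On a patch this is |A|^2: the projections of an orthonormal ambient basis form a Parseval frame
    of the tangent space, which computes the Hilbert-Schmidt norm of the Weingarten map. *)
Definition shape_norm2 (F N : E -> 'rV[R]_n.+1) z : R :=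
  \sum_k dot (row k (frame F z) *m jac N z) (row k (frame F z) *m jac N z).

Variables (U U' : set E) (F N Q M : E -> 'rV[R]_n.+1) (H H' : E -> R).
Hypothesis PF : flow_patch U F N H.
Hypothesis PQ : flow_patch U' Q M H'.
Variables (z z' : E) (delta : R).
Hypotheses (Uz : U z) (Uz' : U' z').

Let Z y y' := two_point delta (H y) (F y) (Q y') (N y).

Section Line.
Variables xi xi' : E.
Let W := [set s : R | U (z + s *: xi)] `&` [set s : R | U' (z' + s *: xi')].

Let oW : open W.
Proof.
by apply: openI; apply: line_open; [exact: patch_open PF|exact: patch_open PQ].
Qed.

Let W0 : W 0.
Proof. by split; rewrite /= scale0r addr0. Qed.

Let h (s : R) := H (z + s *: xi).
Let p (s : R) := F (z + s *: xi).
Let q (s : R) := Q (z' + s *: xi').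
Let nu (s : R) := N (z + s *: xi).

Let sh : smooth_on_open W h.
Proof.
by apply: smooth_subset (smooth_line z xi (patch_open PF) (patch_H PF)) => s [].
Qed.

Let sp : vsmooth W p.
Proof.
by apply: vsmooth_subset (vsmooth_line z xi (patch_open PF) (patch_F PF)) => s [].
Qed.

Let sq : vsmooth W q.
Proof.
by apply: vsmooth_subset (vsmooth_line z' xi' (patch_open PQ) (patch_F PQ)) => s [].
Qed.

Let snu : vsmooth W nu.
Proof.
by apply: vsmooth_subset (vsmooth_line z xi (patch_open PF) (patch_N PF)) => s [].
Qed.

Let dE (s : R) : W s -> vderive (1 : R) (fun s => q s - p s) s =
  vderive xi' Q (z' + s *: xi') - vderive xi F (z + s *: xi).
Proof. by move=> Ws; rewrite (vderiveB _ sq sp Ws) !vderive_line. Qed.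

Let d2E : vderive (1 : R) (vderive (1 : R) (fun s => q s - p s)) 0 =
  vderive xi' (vderive xi' Q) z' - vderive xi (vderive xi F) z.
Proof.
rewrite (vderive_near _ oW W0 dE) (vderiveB _ (U := W))//.
- by rewrite !vderive_line !scale0r !addr0.
- apply: vsmooth_subset (vsmooth_line z' xi' (patch_open PQ)
    (vsmooth_vderive _ (patch_F PQ))) => s; exact: proj2.
- apply: vsmooth_subset (vsmooth_line z xi (patch_open PF)
    (vsmooth_vderive _ (patch_F PF))) => s; exact: proj1.
Qed.

Let nu2E : vderive (1 : R) (vderive (1 : R) nu) 0 = vderive xi (vderive xi N) z.
Proof.
rewrite (vderive_near _ oW W0 (fun s _ => vderive_line N z xi s)).
by rewrite vderive_line scale0r addr0.
Qed.

Let h2E : 'D_1 ('D_1 h) 0 = 'D_xi ('D_xi H) z.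
Proof.
rewrite (derive_near _ oW W0 (fun s _ => derive_line H z xi s)).
by rewrite (derive_line ('D_xi H)) scale0r addr0.
Qed.

Lemma smooth_two_point_line :
  smooth_on_open W (fun s => Z (z + s *: xi) (z' + s *: xi')).
Proof. exact: (smooth_quadratic delta oW sh (vsmoothB oW sq sp) snu). Qed.

Lemma two_point_line_open : open W /\ W 0.
Proof. exact: conj oW W0. Qed.

Lemma derive_two_point : 'D_1 (fun s : R => Z (z + s *: xi) (z' + s *: xi')) 0 =
  'D_xi H z / 2 * dot (Q z' - F z) (Q z' - F z)
  + H z * dot (Q z' - F z) (vderive xi' Q z' - vderive xi F z)
  + delta * (dot (vderive xi' Q z' - vderive xi F z) (N z)
             + dot (Q z' - F z) (vderive xi N z)).
Proof.
have e := @derive_quadratic R R _ _ delta h (fun s => q s - p s) nu 1 oW sh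
  (vsmoothB oW sq sp) snu 0 W0.
apply: etrans e _; rewrite (dE W0).
by rewrite vderive_line derive_line /p /q /h /nu !scale0r !addr0.
Qed.

Lemma derive2_two_point :
  'D_1 ('D_1 (fun s : R => Z (z + s *: xi) (z' + s *: xi'))) 0 =
  'D_xi ('D_xi H) z / 2 * dot (Q z' - F z) (Q z' - F z)
  + 2 * 'D_xi H z * dot (Q z' - F z) (vderive xi' Q z' - vderive xi F z)
  + H z * (dot (vderive xi' Q z' - vderive xi F z) (vderive xi' Q z' - vderive xi F z)
    + dot (Q z' - F z) (vderive xi' (vderive xi' Q) z' - vderive xi (vderive xi F) z))
  + delta * (dot (vderive xi' (vderive xi' Q) z' - vderive xi (vderive xi F) z) (N z)
    + 2 * dot (vderive xi' Q z' - vderive xi F z) (vderive xi N z)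
    + dot (Q z' - F z) (vderive xi (vderive xi N) z)).
Proof.
have e := @derive2_quadratic R R _ _ delta h (fun s => q s - p s) nu 1 oW sh
  (vsmoothB oW sq sp) snu 0 W0.
apply: etrans e _; rewrite d2E nu2E h2E (dE W0).
by rewrite vderive_line derive_line /p /q /h /nu !scale0r !addr0.
Qed.

End Line.

Hypothesis Zmin : \forall y \near z & y' \near z',
  y.2 = z.2 -> y'.2 = z'.2 -> Z z z' <= Z y y'.

(** Lines in spatial directions keep both times fixed, so [Zmin] applies along them and one variable
    is enough. *)
Let line_test c c' :
  let f (s : R) := Z (z + s *: dx c) (z' + s *: dx c') in
  'D_1 f 0 = 0 /\ 0 <= 'D_1 ('D_1 f) 0.
Proof.
have [oW W0] := two_point_line_open (dx c) (dx c').
apply: second_derivative_test oW (smooth_two_point_line _ _) W0 _.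
rewrite !scale0r !addr0.
have c1 : (z + s *: dx c) @[s --> (0 : R)] --> z.
  have cc : continuous (fun s : R => z + s *: (dx c : E)) by exact: line_continuous.
  by have := cc 0; rewrite /continuous_at scale0r addr0.
have c2 : (z' + s *: dx c') @[s --> (0 : R)] --> z'.
  have cc : continuous (fun s : R => z' + s *: (dx c' : E)) by exact: line_continuous.
  by have := cc 0; rewrite /continuous_at scale0r addr0.
have nP : \forall s \near (0 : R), (z + s *: (dx c : E)).2 = z.2 ->
    (z' + s *: (dx c' : E)).2 = z'.2 ->
    Z z z' <= Z (z + s *: dx c) (z' + s *: dx c') by exact: (cvg_pair c1 c2 Zmin).
apply: filterS nP => s; apply.
- by rewrite /= scaler0 addr0.
- by rewrite /= scaler0 addr0.
Qed.

Let rho := dot (H z *: (Q z' - F z) + delta *: N z) (M z').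

Lemma two_point_rho : rho ^+ 2 = delta ^+ 2 + 2 * H z * Z z z'.
Proof.
have [oU sF sN sH N1 FN imm Ft Hdiv] := PF.
have [oU' sQ sM sH' M1 QM imm' Qt Hdiv'] := PQ.
apply: (critical_point_rho (n := n) (JQ := jac Q z') (b := fun k => row k (frame Q z'))).
- exact: N1.
- exact: M1.
- by move=> k; rewrite -(vderive_dx _ sQ Uz') (frameE sQ M1 QM imm').
- move=> c; have [+ _] := line_test 0 c.
  have D0 : 'D_(dx 0) H z = 0 by exact: derive0.
  rewrite derive_two_point (vderive_dx _ sF Uz) (vderive_dx _ sN Uz) D0.
  rewrite (vderive_dx _ sQ Uz') !mul0mx subr0 dot0r => e.
  by rewrite dotDr !dotZr -[RHS]e (dotC (c *m _)) mul0r mul0r add0r addr0.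
Qed.

(* At a spatial minimum of Z the Hessian is nonnegative along the directions
   whose images under the two embeddings are the tangential projections of one
   and the same ambient basis vector. *)
Lemma two_point_evolution : rho != 0 ->
  (shape_norm2 F N z + 2 * dot (vderive dt N z) (M z') / rho) * Z z z'
  <= 'D_1 (fun s : R => Z (z + s *: dt) (z' + s *: dt)) 0.
Proof.
move=> rho0.
have [oU sF sN sH N1 FN imm Ft Hdiv] := PF.
have [oU' sQ sM sH' M1 QM imm' Qt Hdiv'] := PQ.
have vF c : vderive (dx c) F z = c *m jac F z by exact: vderive_dx.
have vN c : vderive (dx c) N z = c *m jac N z by exact: vderive_dx.
have vQ c : vderive (dx c) Q z' = c *m jac Q z' by exact: vderive_dx.
have HG c : 'D_(dx c) H z = dot (c *m jac F z) (vderive dt N z).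
  by rewrite -vF (dot_vderive_dt oU sF sN N1 FN sH Ft).
pose a k := row k (frame F z); pose b k := row k (frame Q z').
rewrite derive_two_point Ft// Qt//.
have -> : - H' z' *: M z' - - H z *: N z = H z *: N z - H' z' *: M z'.
  by rewrite !scaleNr opprK addrC.
rewrite (mulrDr delta) addrA /Z /two_point.
apply: (critical_point_inequality (JF := jac F z) (JN := jac N z) (JQ := jac Q z')
  (a := a) (b := b)
  (Fkk := fun k => vderive (dx (a k)) (vderive (dx (a k)) F) z)
  (Nkk := fun k => vderive (dx (a k)) (vderive (dx (a k)) N) z)
  (Qkk := fun k => vderive (dx (b k)) (vderive (dx (b k)) Q) z')
  (Hkk := fun k => 'D_(dx (a k)) ('D_(dx (a k)) H) z)) => //.
- exact: N1.
- exact: M1.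
- by move=> c; rewrite -vF FN.
- by move=> c; rewrite -vN (dot_vderive_normal oU sN N1).
- by rewrite (dot_vderive_normal oU sN N1).
- by move=> c d; rewrite -!vF -!vN (weingarten_sym oU sF sN FN).
- by move=> k; rewrite -vF (frameE sF N1 FN imm).
- by move=> k; rewrite -vQ (frameE sQ M1 QM imm').
- exact: (sum_dot_frame oU sF sN N1 FN imm Hdiv Uz).
- exact: (sum_dot_frame oU' sQ sM M1 QM imm' Hdiv' Uz').
- by move=> k; rewrite -vN (dot_vderive2_normal oU sN N1).
- move=> c; rewrite -HG (codazzi oU sF sN N1 FN imm Hdiv)//.
  by apply: eq_bigr => k _; rewrite vF vN.
- rewrite (mean_curvature_evolution oU sF sN N1 FN imm sH Ft Hdiv)//.
  by apply: eq_bigr => k _; rewrite vN.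
- move=> c; have [+ _] := line_test 0 c.
  rewrite derive_two_point vF vN HG vQ !mul0mx dot0l subr0 dot0r => e.
  by rewrite dotDr !dotZr -[RHS]e (dotC (c *m _)) mul0r mul0r add0r addr0.
- move=> c; have [+ _] := line_test c 0.
  have FNc : dot (c *m jac F z) (N z) = 0 by rewrite -vF FN.
  rewrite derive_two_point vF vN HG vQ !mul0mx sub0r dotNr dotNl FNc oppr0 add0r.
  by move=> e; rewrite -[RHS]e mulrN mulrAC.
- apply: sumr_ge0 => k _; have [_] := line_test (a k) (b k).
  by rewrite derive2_two_point HG vF vN vQ.
Qed.

End FlowPatch.

(** * Independence of the chart *)

Lemma dot_delta_mul (R : realType) (n m : nat) (A B : 'M[R]_(n, m)) i j :
  dot (delta_mx 0 i *m A) (delta_mx 0 j *m B) = (A *m B^T) i j.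
Proof. by rewrite -!rowE mxE; apply: eq_bigr => k _; rewrite !mxE. Qed.

Lemma derive_coord (R : realType) (V : normedModType R) (m : nat)
    (F : V -> 'rV[R]_m) v x i :
  derivable F x v -> ('D_v F x) 0 i = 'D_v (fun y => F y 0 i) x.
Proof. by move=> dF; rewrite derive_mx// mxE. Qed.

Lemma derive_comp (R : realType) (V W W' : normedModType R) (f : V -> W)
    (g : W -> W') x v :
  differentiable f x -> differentiable g (f x) ->
  'D_v (g \o f) x = 'D_('d f x v) g (f x).
Proof.
move=> df dg; rewrite (deriveE _ (differentiable_comp df dg)) (deriveE _ dg).
exact: (congr1 (fun h => h v) (diff_comp df dg)).
Qed.

Lemma derive_dot_pt (R : realType) (V : normedModType R) (m : nat)
    (F G : V -> 'rV[R]_m) v x :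
  derivable F x v -> derivable G x v ->
  'D_v (fun y => dot (F y) (G y)) x = dot ('D_v F x) (G x) + dot (F x) ('D_v G x).
Proof.
move=> dF dG; have dFi i : derivable (fun y => F y 0 i) x v.
  exact: (derivable_mxP F x v).1 dF 0 i.
have dGi i : derivable (fun y => G y 0 i) x v.
  exact: (derivable_mxP G x v).1 dG 0 i.
have -> : (fun y => dot (F y) (G y)) = \sum_(i < m) ((fun y => F y 0 i) * (fun y => G y 0 i)).
  by apply/funext => y; rewrite fct_sumE.
rewrite derive_sum; last by move=> i; exact: derivableM.
rewrite -big_split; apply: eq_bigr => i _ /=.
rewrite (deriveM (dFi i) (dGi i)) (derive_coord i dF) (derive_coord i dG) addrC.
by congr (_ + _); exact: mulrC.
Qed.

Section ChartInvariance.
Variables (R : realType) (n : nat) (M : smoothManifold R n).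

Lemma chart_atP (x : M) : atlas (chart_at x) /\ cdom (chart_at x) x.
Proof. exact: projT2 (cid (atlas_cover x)). Qed.

(** Makes the definition, tied to [chart_at], available in any chart of the atlas. There g = J J^T,
    and orthogonality of [nu] to tangent vectors gives h = K J^T with [K] the Jacobian of the
    normal; by cyclicity of the trace, tr (g^-1 h) = tr (J^+ K), where J^+ is [tangent_pinv J]. *)
Lemma mean_curvature_trace (F nu : M -> 'rV[R]_n.+1) (c : chart R n M) u
    (a : 'I_n.+1 -> 'rV[R]_n) :
  smooth_map F -> immersion F -> (forall x, dot (nu x) (nu x) = 1) ->
  (forall c, atlas c -> forall u, cimg c u ->
    forall v, dot ('D_v (F \o cinv c) u) (nu (cinv c u)) = 0) ->
  atlas c -> cimg c u -> differentiable (nu \o cinv c) u ->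
  (forall k, 'D_(a k) (F \o cinv c) u
    = delta_mx 0 k - nu (cinv c u) 0 k *: nu (cinv c u)) ->
  mean_curvature F nu (cinv c u) = \sum_k 'D_(a k) (nu \o cinv c) u 0 k.
Proof.
move=> sF iF nu1 nuF ac cu dn aE.
set x := cinv c u in aE *; rewrite /mean_curvature.
set c' := chart_at x; have [ac' c'x] : atlas c' /\ cdom c' x by exact: chart_atP.
set u' := cmap c' x; have c'u' : cimg c' u' by exact: cmap_img.
have xE : cinv c' u' = x by exact: cmapK.
pose phi := cmap c \o cinv c'.
have phiu : phi u' = u by rewrite /phi /= xE /x cinvK.
have dphi : differentiable phi u'.
  have [+ _] := atlas_compatible ac' ac 1%N; apply; exists x => //; split => //.
  exact: cinv_dom.
have nearc : \near u', cimg c' u' /\ cdom c (cinv c' u').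
  apply: filterI; first by apply: open_nbhs_nbhs; split=> //; exact: cimg_open.
  apply: (cinv_continuous c'u'); rewrite xE; apply: open_nbhs_nbhs.
  by split; [exact: cdom_open|exact: cinv_dom].
have near_comp (W : normedModType R) (f : M -> W) :
    \near u', ((f \o cinv c) \o phi) u' = (f \o cinv c') u'.
  by apply: filterS nearc => y [_ yc] /=; rewrite cmapK.
have dcomp (W : normedModType R) (f : M -> W) : differentiable (f \o cinv c) u ->
    differentiable (f \o cinv c') u' /\
    forall v, 'D_v (f \o cinv c') u' = 'D_('d phi u' v) (f \o cinv c) u.
  move=> df; rewrite -phiu in df; have dfp := differentiable_comp dphi df.
  split; first exact: near_eq_differentiable (near_comp _ f) dfp.
  move=> v; rewrite -(near_eq_derive v (near_comp _ f)) -phiu.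
  exact: derive_comp dphi df.
have dp : differentiable (F \o cinv c) u by have [+ _] := sF c ac 1%N; exact.
have [dp' Dp'] := dcomp _ F dp; have [dn' Dn'] := dcomp _ nu dn.
set p' := F \o cinv c' in dp' Dp'; set n' := nu \o cinv c' in dn' Dn'.
pose J := jacobian p' u'; pose K := jacobian n' u'.
have gE : first_fundamental_form c' F x = J *m J^T.
  apply/matrixP => i j; rewrite mxE /partial -/p' -/u' !deriveEjacobian// -/J.
  exact: dot_delta_mul.
have hE : second_fundamental_form c' F nu x = K *m J^T.
  apply/matrixP => i j; rewrite mxE -/p' -/u'.
  have -> : nu x = n' u' by rewrite /n' /= xE.
  have D0 : 'D_(delta_mx 0 i) (fun y => dot (partial p' j y) (n' y)) u' = 0.
    rewrite (near_eq_derive _ (g := cst 0)) ?derive_cst//.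
    by apply: filterS nearc => y [c'y _]; exact: nuF.
  have dpp : derivable (partial p' j) u' (delta_mx 0 i).
    by apply: diff_derivable; have [_ /(_ (delta_mx 0 j))[+ _]] := sF c' ac' 2%N; exact.
  have dnn : derivable n' u' (delta_mx 0 i) by exact: diff_derivable.
  have /eqP := etrans (esym (derive_dot_pt dpp dnn)) D0.
  rewrite addr_eq0 => /eqP e; rewrite [LHS](congr1 -%R e) opprK.
  rewrite /partial (deriveEjacobian _ dp') (deriveEjacobian _ dn') -/J -/K.
  by rewrite dotC; exact: dot_delta_mul.
rewrite gE hE mulmxA mxtrace_mulC mulmxA -/(tangent_pinv J).
apply: eq_bigr => k _.
(* Both vectors have the same image under the injective differential of [F] in the chart [c]. *)
have -> : a k = 'd phi u' (row k (tangent_pinv J)).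
  apply/eqP; rewrite -subr_eq0; apply/eqP; apply: (iF c ac u cu).
  rewrite (deriveEjacobian _ dp) mulmxBl -!(deriveEjacobian _ dp) -Dp' aE.
  rewrite (deriveEjacobian _ dp').
  rewrite (@row_tangent_pinv _ _ _ (nu x)) ?subrr//.
  - move=> v; rewrite -deriveEjacobian//; exact: (iF c' ac' u' c'u').
  - by move=> v; rewrite -deriveEjacobian// -[in X in dot _ X]xE; exact: nuF.
rewrite -Dn' deriveEjacobian// -row_mul [RHS]mxE.
by [].
Qed.

End ChartInvariance.

(** * Extension of the flow in charts *)

Section Slices.
Variables (R : realType) (n : nat).
Local Notation E := ('rV[R]_n * R)%type.
Local Notation dx c := ((c : 'rV[R]_n), (0 : R)).
Local Notation dt := ((0 : 'rV[R]_n), (1 : R)).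

Lemma derive_slice (W : normedModType R) (f : E -> W) (a u : 'rV[R]_n) (t : R) :
  'D_a (fun u => f (u, t)) u = 'D_(dx a) f (u, t).
Proof.
suff E : (fun h : R => h^-1 *: (((fun u => f (u, t)) \o shift u) (h *: a) - f (u, t))) =
    (fun h : R => h^-1 *: ((f \o shift (u, t)) (h *: (dx a : E)) - f (u, t))).
  by rewrite /derive E.
apply/funext => h /=; congr (_ *: (f _ - _)).
by rewrite [RHS]surjective_pairing/= scaler0 add0r.
Qed.

Lemma differentiable_slice (W : normedModType R) (f : E -> W) (u : 'rV[R]_n) (t : R) :
  differentiable f (u, t) -> differentiable (fun u => f (u, t)) u.
Proof.
move=> df; apply: (@differentiable_comp _ _ _ _ (fun u => (u, t)) f) => //.
Qed.

Lemma vsmooth_differentiable (V : normedModType R) m (U : set V) (F : V -> 'rV[R]_m) x :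
  vsmooth U F -> U x -> differentiable F x.
Proof.
move=> sF Ux.
have -> : F = \sum_(i < m) (fun y => F y 0 i *: delta_mx 0 i).
  by apply/funext => y; rewrite fct_sumE [LHS]row_sum_delta.
apply: differentiable_sum => i; apply: differentiableZl.
exact: smooth_differentiable (sF i) Ux.
Qed.

Lemma open_positive (V : normedModType R) (U : set V) (f : V -> R) : open U ->
  smooth_on_open U f -> open [set x | U x /\ 0 < f x].
Proof.
move=> oU sf; rewrite openE => x [Ux fx].
apply: filterI; first exact: open_nbhs_nbhs.
have := smooth_continuous sf Ux; rewrite /prop_for /continuous_at.
by move=> /cvgr_gt/(_ 0 fx).
Qed.

Lemma cvg_dnbhs_sub (t : R) : (s - t) @[s --> t^'] --> (0 : R)^'.
Proof.
move=> A [e /= e0 eA]; exists e => //= s st s0.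
apply: eA; last by rewrite subr_eq0.
by rewrite /ball_/= sub0r normrN distrC.
Qed.

Lemma time_interval_right (T : \bar R) t : time_interval T t ->
  exists2 e : R, 0 < e & forall s, t <= s < t + e -> time_interval T s.
Proof.
move=> [t0 tT]; have /nbhs_ballP[e /= e0 eT] : nbhs t [set r | (r%:E < T)%E].
  by apply: open_nbhs_nbhs; split => //; exact: open_ereal_lt.
exists e => // s /andP[ts se]; split; first exact: le_trans ts.
apply: eT; rewrite -ball_normE /ball_/= distrC ger0_norm ?subr_ge0//.
by rewrite ltrBlDl.
Qed.

(** Other times of the interval accumulate at [t] from the right, so the derivative within the
    interval is unique even at 0. *)
Lemma time_interval_proper (T : \bar R) t : time_interval T t ->
  ProperFilter (within (time_interval T) t^').
Proof.
move=> It; apply: Build_ProperFilter.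
move=> [e /= e0 eA].
have [r r0 rI] := time_interval_right It.
have m0 : 0 < Num.min e r by rewrite lt_min e0.
apply: (eA (t + Num.min e r / 2)).
- rewrite /ball_/= opprD addrA subrr sub0r normrN gtr0_norm ?divr_gt0//.
  by rewrite ltr_pdivrMr// (le_lt_trans (y := e)) ?ge_min ?lexx// ltr_pMr// ltr1n.
- by rewrite -subr_eq0 addrC addKr gt_eqF// divr_gt0.
- apply: rI; rewrite lerDl divr_ge0 ?ltW//= ltrD2l ltr_pdivrMr//.
  by rewrite (le_lt_trans (y := r)) ?ge_min ?lexx ?orbT// ltr_pMr// ltr1n.
Qed.

End Slices.

Section FlowInCharts.
Variables (R : realType) (n : nat) (M : smoothManifold R n) (T : \bar R).
Variables (X nu : M -> R -> 'rV[R]_n.+1) (Omega : R -> set 'rV[R]_n.+1).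
Hypothesis X_smooth : smooth_family T X.
Hypothesis X_embedding : forall t, time_interval T t -> smooth_embedding (X^~ t).
Hypothesis nu_normal : forall t, time_interval T t ->
  outward_unit_normal (X^~ t) (Omega t) (nu^~ t).
Hypothesis X_mcf : mean_curvature_flow T X nu.
Hypothesis H_gt0 : forall x t, time_interval T t ->
  0 < mean_curvature (X^~ t) (nu^~ t) x.

Local Notation I := (time_interval T).
Local Notation mc x t := (mean_curvature (X^~ t) (nu^~ t) x).
Local Notation E := ('rV[R]_n * R)%type.
Local Notation dx c := ((c : 'rV[R]_n), (0 : R)).
Local Notation dt := ((0 : 'rV[R]_n), (1 : R)).

Section Extension.
Variables (c : chart R n M) (U : set E) (g : E -> 'rV[R]_n.+1).
Hypothesis ac : atlas c.
Hypothesis oU : open U.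
Hypothesis sg : vsmooth U g.
Hypothesis gE : forall z, U z -> cimg c z.1 /\ (I z.2 -> X (cinv c z.1) z.2 = g z).

Lemma near_slice z : U z -> \forall u \near z.1, U (u, z.2).
Proof.
move=> Uz; have nU : nbhs z U by exact: open_nbhs_nbhs.
exact: (cvg_pair (f := id) (@cvg_id _ (nbhs z.1)) (cvg_cst z.2) nU).
Qed.

Lemma near_time z : U z -> \forall s \near z.2, U (z.1, s).
Proof.
move=> Uz; have nU : nbhs z U by exact: open_nbhs_nbhs.
exact: (cvg_pair (g := id) (cvg_cst z.1) (@cvg_id _ (nbhs z.2)) nU).
Qed.

Lemma extension_space z a : U z -> I z.2 ->
  'D_a (X^~ z.2 \o cinv c) z.1 = vderive (dx a) g z.
Proof.
move=> Uz Iz.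
rewrite -derive_vderive; last exact: vsmooth_differentiable sg Uz.
rewrite [in RHS](surjective_pairing z) -derive_slice; apply: near_eq_derive.
by apply: filterS (near_slice Uz) => u Uu /=; have [_ /(_ Iz)] := gE Uu.
Qed.

(** The extension has a two-sided derivative, the flow possibly only a one-sided one; they agree by
    uniqueness of limits within [I]. *)
Lemma extension_time z : U z -> I z.2 ->
  vderive dt g z = - mc (cinv c z.1) z.2 *: nu (cinv c z.1) z.2.
Proof.
move=> Uz Iz; have PF := time_interval_proper Iz.
have dg : differentiable g z by exact: vsmooth_differentiable sg Uz.
have h1 := @X_mcf (cinv c z.1) z.2 Iz.
rewrite -derive_vderive//.
suff h2 : (s - z.2)^-1 *: (X (cinv c z.1) s - X (cinv c z.1) z.2)
    @[s --> within I (z.2)^'] --> 'D_dt g z by exact: (cvg_unique _ h2 h1).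
have dd : h^-1 *: ((g \o shift z) (h *: (dt : E)) - g z) @[h --> 0^'] --> 'D_dt g z.
  exact: (diff_derivable (v := dt) dg).
have dd1 : (s - z.2) @[s --> z.2^'] --> (0 : R)^' by exact: cvg_dnbhs_sub.
have dd2 : (s - z.2)^-1 *: ((g \o shift z) ((s - z.2) *: (dt : E)) - g z)
    @[s --> within I (z.2)^'] --> 'D_dt g z.
  by apply: cvg_within_filter; exact: (cvg_comp _ _ dd1 dd).
apply: cvg_trans dd2; apply: near_eq_cvg.
rewrite near_withinE.
have nz : \forall s \near z.2^', U (z.1, s).
  by apply: cvg_within; exact: near_time.
apply: filterS nz => s Us Is /=.
have [_ /(_ Is)] := gE Us; have [_ /(_ Iz)] := gE Uz => -> -> /=.
congr (_ *: (g _ - _)).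
by rewrite [LHS]surjective_pairing/= scaler0 add0r [_ *: 1]mulr1 subrK.
Qed.

Let gt := vderive dt g.

(* Since X_t = - H nu with H > 0 and |nu| = 1, the mean curvature is |X_t| and
   the normal is - X_t / |X_t|, so both extend smoothly along with X. *)
Definition extension_speed z := dot (gt z) (gt z) `^ 2^-1.
Definition extension_normal z := - (extension_speed z)^-1 *: gt z.

Hypothesis gt_neq0 : forall z, U z -> 0 < dot (gt z) (gt z).
Hypothesis gram_g : forall z, U z -> jac g z *m (jac g z)^T \in unitmx.

Let sgt : vsmooth U gt. Proof. exact: vsmooth_vderive. Qed.

Let speed_gt0 z : U z -> 0 < extension_speed z.
Proof. by move=> Uz; apply: powR_gt0; exact: gt_neq0. Qed.

Lemma smooth_extension_speed : smooth_on_open U extension_speed.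
Proof. by apply: smooth_powR => //; exact: smooth_dot. Qed.

Lemma vsmooth_extension_normal : vsmooth U extension_normal.
Proof.
apply: vsmoothZ => //; apply: smoothN => //; apply: smoothV => //.
- by move=> z /speed_gt0; exact: lt0r_neq0.
- exact: smooth_extension_speed.
Qed.

Lemma extension_value z : U z -> I z.2 ->
  extension_speed z = mc (cinv c z.1) z.2 /\
  extension_normal z = nu (cinv c z.1) z.2.
Proof.
move=> Uz Iz; have H0 := H_gt0 (cinv c z.1) Iz.
have [nu1 _ _] := nu_normal Iz.
have sE : extension_speed z = mc (cinv c z.1) z.2.
  rewrite /extension_speed /gt (extension_time Uz Iz) !dotZl !dotZr nu1 mulr1.
  rewrite mulrNN -expr2 powR12_sqrt ?sqr_ge0// sqrtr_sqr.
  by rewrite ger0_norm// ltW.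
split=> //; rewrite /extension_normal sE /gt (extension_time Uz Iz) scalerA mulrNN.
by rewrite mulVf ?scale1r// lt0r_neq0.
Qed.

Lemma smooth_shape_norm2 : smooth_on_open U (shape_norm2 g extension_normal).
Proof.
have sA : msmooth U (fun z => frame g z *m jac extension_normal z).
  apply: msmooth_mul => //; first exact: msmooth_frame.
  by apply: msmooth_jac => //; exact: vsmooth_extension_normal.
apply: smooth_sum => // k; apply: smooth_sum => // j.
under eq_fun do rewrite -row_mul mxE.
by apply: smoothM => //; exact: sA.
Qed.

(** A patch needs its identities on an open set, and [g] is tied to the flow only at times of [I];
    hence the restriction to interior times. *)
Lemma extension_patch : flow_patch (U `&` [set z | 0 < z.2 /\ (z.2%:E < T)%E])
  g extension_normal extension_speed.
Proof.
have sub : U `&` [set z | 0 < z.2 /\ (z.2%:E < T)%E] `<=` U by move=> z [].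
have UI z : (U `&` [set z | 0 < z.2 /\ (z.2%:E < T)%E]) z -> U z /\ I z.2.
  by move=> [Uz [z0 zT]]; split=> //; split=> //; exact: ltW.
split.
- apply: openI => //.
  have -> : [set z : E | 0 < z.2 /\ (z.2%:E < T)%E] =
     snd @^-1` ([set t | 0 < t] `&` [set t : R | (t%:E < T)%E]) by [].
  apply: open_comp => [z _|]; first exact: cvg_snd.
  by apply: openI; [exact: open_gt|exact: open_ereal_lt].
- exact: vsmooth_subset sg.
- exact: vsmooth_subset vsmooth_extension_normal.
- exact: smooth_subset smooth_extension_speed.
- move=> z /UI[Uz Iz]; have [_ ->] := extension_value Uz Iz.
  by have [+ _ _] := nu_normal Iz; exact.
- move=> z a /UI[Uz Iz]; have [_ ->] := extension_value Uz Iz.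
  rewrite -extension_space//; have [_ + _] := nu_normal Iz; apply => //.
  by have [] := gE Uz.
- move=> z a /UI[Uz Iz]; rewrite -extension_space//.
  have [_ + _] := X_embedding Iz; apply => //.
  by have [] := gE Uz.
- move=> z /UI[Uz Iz]; rewrite extension_time//.
  by have [-> ->] := extension_value Uz Iz.
- move=> z /UI[Uz Iz] a aE.
  have cz : cimg c z.1 by have [] := gE Uz.
  have [HE NE] := extension_value Uz Iz.
  have nN : \forall u \near z.1, extension_normal (u, z.2) = nu (cinv c u) z.2.
    apply: filterS (near_slice Uz) => u Uu.
    by have [_] := @extension_value (u, z.2) Uu Iz.
  have dN : differentiable extension_normal z.
    exact: vsmooth_differentiable vsmooth_extension_normal Uz.
  have dnu : differentiable ((nu^~ z.2) \o cinv c) z.1.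
    apply: near_eq_differentiable nN _; apply: differentiable_slice.
    by rewrite -surjective_pairing.
  have [sX iX _] := X_embedding Iz; have [nu1 nuX _] := nu_normal Iz.
  rewrite HE (mean_curvature_trace (a := a) sX iX nu1 nuX ac cz dnu); last first.
    by move=> k; rewrite (extension_space _ Uz Iz) aE NE.
  apply: eq_bigr => k _; rewrite -(near_eq_derive _ nN) derive_slice.
  by rewrite -surjective_pairing derive_vderive.
Qed.

End Extension.

(** [U] is a full neighbourhood of the base point even for [t0 = 0], which later gives continuity
    and bounds up to the initial time. *)
Lemma extended_patch x0 t0 : I t0 ->
  exists (c : chart R n M) (U : set E) (g N : E -> 'rV[R]_n.+1) (H : E -> R),
  [/\ cdom c x0, open U & U (cmap c x0, t0)] /\
  [/\ vsmooth U g, vsmooth U N, smooth_on_open U H & smooth_on_open U (shape_norm2 g N)] /\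
  (forall z, U z -> cimg c z.1 /\ (I z.2 -> [/\ X (cinv c z.1) z.2 = g z,
     nu (cinv c z.1) z.2 = N z & mc (cinv c z.1) z.2 = H z])) /\
  flow_patch (U `&` [set z | 0 < z.2 /\ (z.2%:E < T)%E]) g N H.
Proof.
move=> It0; pose c := chart_at x0; have [ac cx] := chart_atP x0; rewrite -/c in ac cx.
have a0 : (cimg c `*` I) (cmap c x0, t0) by split=> //=; exact: cmap_img.
have [U0 [g [[oU0 U0z] sg0 gE0]]] := X_smooth ac a0.
pose U1 := U0 `&` (fst @^-1` (cimg c)).
have oU1 : open U1.
  apply: openI => //; apply: open_comp; last exact: cimg_open.
  by move=> z _; exact: cvg_fst.
have sg1 : vsmooth U1 g.
  by apply: (vsmooth_subset (U := U0)); [move=> z []|exact: vsmooth_smooth].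
have gE1 z : U1 z -> cimg c z.1 /\ (I z.2 -> X (cinv c z.1) z.2 = g z).
  move=> [U0z' cz]; split=> // Iz; rewrite -gE0//.
  by rewrite inE; split=> //; split.
have U1z : U1 (cmap c x0, t0) by split=> //; exact: cmap_img.
(* Two open conditions are imposed that hold at the base point: nonzero velocity, since H > 0, and
   an invertible Gram matrix, since [X] is an immersion. The determinant is squared to make the
   latter a positivity condition. *)
pose U2 := [set z | U1 z /\ 0 < dot (vderive dt g z) (vderive dt g z)].
have oU2 : open U2.
  by apply: open_positive => //; apply: smooth_dot => //; exact: vsmooth_vderive.
pose gram z := jac g z *m (jac g z)^T.
pose U := [set z | U2 z /\ 0 < \det (gram z) * \det (gram z)].
have sgram : smooth_on_open U2 (fun z => \det (gram z)).
  have sJ : msmooth U2 (jac g).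
    by apply: msmooth_jac; apply: vsmooth_subset sg1 => z [].
  apply: smooth_det => //; apply: msmooth_mul => // i j.
  by under eq_fun do rewrite mxE; exact: sJ.
have oU : open U by apply: open_positive => //; exact: smoothM.
have U_U1 : U `<=` U1 by move=> z [[]].
have gE z : U z -> cimg c z.1 /\ (I z.2 -> X (cinv c z.1) z.2 = g z).
  by move=> /U_U1; exact: gE1.
have sg : vsmooth U g by exact: vsmooth_subset sg1.
have gt_neq0 z : U z -> 0 < dot (vderive dt g z) (vderive dt g z) by move=> [[]].
have ug z : U z -> gram z \in unitmx.
  move=> [_]; rewrite unitmxE unitfE; apply: contraTN => /eqP ->.
  by rewrite mul0r ltxx.
exists c, U, g, (extension_normal g), (extension_speed g); split; last split; last split.
- split=> //; split; first split=> //.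
    rewrite (extension_time oU1 sg1 gE1 U1z It0) !dotZl !dotZr.
    have [-> _ _] := nu_normal It0.
    by rewrite mulr1 mulrNN mulr_gt0// H_gt0.
  suff : gram (cmap c x0, t0) \in unitmx.
    by rewrite unitmxE unitfE -expr2 => ?; rewrite exprn_even_gt0.
  apply: gram_unit => v; rewrite -(vderive_dx v sg1 U1z).
  rewrite -(extension_space oU1 sg1 gE1 v U1z It0).
  by have [_ + _] := X_embedding It0; apply => //; exact: cmap_img.
- split=> //; [exact: vsmooth_extension_normal|exact: smooth_extension_speed|].
  exact: smooth_shape_norm2.
- move=> z Uz; have [cz gz] := gE z Uz; split=> // Iz; split; first exact: gz.
    by have [_ ->] := extension_value oU sg gE Uz Iz.
  by have [-> _] := extension_value oU sg gE Uz Iz.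
- exact: (extension_patch ac oU sg gE gt_neq0).
Qed.

End FlowInCharts.

(** * Non-collapsedness and the two-point function *)

Section EuclideanBalls.
Variables (R : realType) (m : nat).
Implicit Types (u v c x y : 'rV[R]_m) (r : R).

Lemma cvg_bigsum (T I : Type) (F : set_system T) (FF : Filter F) (s : seq I)
    (f : I -> T -> R) (a : I -> R) :
  (forall i, f i x @[x --> F] --> a i) ->
  \sum_(i <- s) f i x @[x --> F] --> \sum_(i <- s) a i.
Proof.
move=> fa; elim: s => [|i s IH].
  by under eq_fun do rewrite big_nil; rewrite big_nil; exact: cvg_cst.
by under eq_fun do rewrite big_cons; rewrite big_cons; exact: cvgD.
Qed.

Lemma cvg_dot (T : Type) (F : set_system T) (FF : Filter F)
    (f g : T -> 'rV[R]_m) (a b : 'rV[R]_m) :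
  (forall i, f x 0 i @[x --> F] --> a 0 i) -> (forall i, g x 0 i @[x --> F] --> b 0 i) ->
  dot (f x) (g x) @[x --> F] --> dot a b.
Proof. by move=> fa gb; apply: cvg_bigsum => i; exact: cvgM. Qed.

Lemma dist2_continuous c : continuous (fun y => dot (y - c) (y - c)).
Proof.
move=> y; apply: (@cvg_dot _ (nbhs y) _) => i.
  under eq_fun do rewrite !mxE; rewrite !mxE; apply: cvgB; last exact: cvg_cst.
  exact: coord_continuous.
under eq_fun do rewrite !mxE; rewrite !mxE; apply: cvgB; last exact: cvg_cst.
exact: coord_continuous.
Qed.

Lemma eballE c r : 0 < r -> eball c r = [set y | dot (y - c) (y - c) < r ^+ 2].
Proof.
move=> r0; apply/seteqP; split=> y /=; rewrite /eball /enorm /=.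
  move=> yr; rewrite -(sqr_sqrtr (dot_ge0 (y - c))).
  by rewrite ltr_pXn2r// ?nnegrE ?sqrtr_ge0// ltW.
by move=> yr; rewrite -(ltr_pXn2r (n := 2))// ?nnegrE ?sqrtr_ge0 ?ltW// sqr_sqrtr ?dot_ge0.
Qed.

Lemma eball_open c r : 0 < r -> open (eball c r).
Proof.
move=> r0; rewrite eballE//.
have -> : [set y | dot (y - c) (y - c) < r ^+ 2] =
  (fun y => dot (y - c) (y - c)) @^-1` [set s | s < r ^+ 2] by [].
by apply: open_comp; [move=> y _; exact: dist2_continuous|exact: open_lt].
Qed.

(** From |(1-s)u + sv|^2 = (1-s)|u|^2 + s|v|^2 - s(1-s)|u-v|^2. *)
Lemma eball_convex c r x y (s : R) : 0 < r -> 0 <= s <= 1 ->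
  eball c r x -> eball c r y -> eball c r (x + s *: (y - x)).
Proof.
move=> r0 /andP[s0 s1]; rewrite eballE//= => xr yr.
have -> : x + s *: (y - x) - c = (1 - s) *: (x - c) + s *: (y - c).
  by apply/rowP => i; rewrite !mxE; ring.
have := dot_ge0 (x - y).
have -> : x - y = (x - c) - (y - c) by rewrite opprB addrA subrK.
move: (x - c) (y - c) xr yr => u v; rewrite !dotE (dotC v u) => ur vr uv.
have [->|sp] := eqVneq s 0; first by rewrite subr0 !mul1r !mul0r !addr0.
have {sp s0}s0 : 0 < s by rewrite lt_def sp.
have s1' : 0 <= 1 - s by rewrite subr_ge0.
have h1 : 0 <= (1 - s) * (r ^+ 2 - dot u u) by rewrite mulr_ge0// subr_ge0 ltW.
have h2 : 0 < s * (r ^+ 2 - dot v v) by rewrite mulr_gt0// subr_gt0.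
have h3 := mulr_ge0 (mulr_ge0 (ltW s0) s1') uv.
move: h1 h2 h3; move: (dot u u) (dot u v) (dot v v) => x1 x2 x3.
lra.
Qed.

Lemma eball_boundary c r x : 0 < r -> boundary (eball c r) x ->
  dot (x - c) (x - c) = r ^+ 2.
Proof.
move=> r0 [cx ix]; apply/eqP; rewrite eq_le; apply/andP; split.
  rewrite leNgt; apply/negP => xr.
  have [|y []] := cx [set y | r ^+ 2 < dot (y - c) (y - c)].
    have nx : nbhs (dot (x - c) (x - c)) [set t | r ^+ 2 < t].
      by apply: open_nbhs_nbhs; split=> //; exact: open_gt.
    exact: (@dist2_continuous c x _ nx).
  by rewrite eballE//= => yr /= ry; have := lt_trans yr ry; rewrite ltxx.
rewrite leNgt; apply/negP => xr; apply: ix.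
have -> : interior (eball c r) = eball c r.
  by apply/interior_id; exact: eball_open.
by rewrite eballE.
Qed.

End EuclideanBalls.

(** * Interior balls and the sign of Z *)

Section Noncollapsed.
Variables (R : realType) (n : nat) (M : smoothManifold R n).
Variables (F nu : M -> 'rV[R]_n.+1) (Omega : set 'rV[R]_n.+1) (delta : R).
Hypothesis F_embedding : smooth_embedding F.
Hypothesis F_bounds : bounds F Omega.
Hypothesis nu_normal : outward_unit_normal F Omega nu.
Hypothesis H_gt0 : forall x, 0 < mean_curvature F nu x.
Hypothesis delta_gt0 : 0 < delta.

Local Notation H x := (mean_curvature F nu x).
Local Notation r x := (delta / H x).

Let r_gt0 x : 0 < r x. Proof. by rewrite divr_gt0. Qed.

Let two_pointE x y : two_point delta (H x) (F x) (F y) (nu x) =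
  H x / 2 * (dot (F y - (F x - r x *: nu x)) (F y - (F x - r x *: nu x)) - r x ^+ 2).
Proof.
have -> : F y - (F x - r x *: nu x) = (F y - F x) + r x *: nu x by rewrite opprB addrA addrAC.
have [nu1 _ _] := nu_normal.
rewrite /two_point; move: (F y - F x) => D; rewrite !dotDl !dotDr !dotZl !dotZr nu1 (dotC (nu x)).
have := lt0r_neq0 (H_gt0 x); move: (H x) (dot D D) (dot D (nu x)) => h x1 x2 h0.
by field.
Qed.

Lemma dot_interior_center x s :
  dot (F x - s *: nu x - (F x - r x *: nu x)) (F x - s *: nu x - (F x - r x *: nu x))
  = (r x - s) ^+ 2.
Proof.
have -> : F x - s *: nu x - (F x - r x *: nu x) = (r x - s) *: nu x.
  by apply/rowP => i; rewrite !mxE; ring.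
by have [nu1 _ _] := nu_normal; rewrite dotZl dotZr nu1 mulr1.
Qed.

Lemma normal_direction (w : 'rV[R]_n.+1) x :
  (forall v, dot ('D_v (F \o cinv (chart_at x)) (cmap (chart_at x) x)) w = 0) ->
  w = dot w (nu x) *: nu x.
Proof.
set c := chart_at x; set u := cmap c x => wF.
have [ac cx] := chart_atP x; rewrite -/c in ac cx.
have cu : cimg c u by exact: cmap_img.
have [sF iF _] := F_embedding; have [nu1 nuF _] := nu_normal.
have dF : differentiable (F \o cinv c) u by have [+ _] := sF c ac 1%N; exact.
have nux : nu (cinv c u) = nu x by rewrite cmapK.
apply/rowP => k; rewrite [RHS]mxE -!(dot_delta _ k).
have <- : row k (tangent_pinv (jacobian (F \o cinv c) u)) *m jacobian (F \o cinv c) u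
    + nu x 0 k *: nu x = delta_mx 0 k.
  rewrite (@row_tangent_pinv _ _ _ (nu x)) ?subrK//.
  - by move=> v; rewrite -deriveEjacobian//; exact: (iF c ac u cu).
  - by move=> v; rewrite -deriveEjacobian// -nux; exact: nuF.
rewrite !dotDl -!deriveEjacobian// wF -nux nuF// nux !dotZl nu1 (dotC w).
by ring.
Qed.

(** The definition leaves the centre [c] of the ball free. The hypersurface, being the boundary of
    the open set [Omega], avoids the ball, so its distance to [c] is least at [x]; hence [F x - c]
    is normal and [c] is determined up to the side. *)
Lemma noncollapsed_two_point : noncollapsed delta F Omega nu ->
  forall x y, 0 <= two_point delta (H x) (F x) (F y) (nu x).
Proof.
move=> nc x y; have [c [BO Bx]] := nc x; have [oO bO] := F_bounds.
have xr := eball_boundary (r_gt0 x) Bx.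
have yr y' : r x ^+ 2 <= dot (F y' - c) (F y' - c).
  rewrite leNgt; apply/negP => y'r.
  have [_] : boundary Omega (F y') by rewrite bO; exists y'.
  by apply; rewrite (interior_id _).1//; apply: BO; rewrite eballE.
have [nu1 _ nuO] := nu_normal.
have wE : F x - c = dot (F x - c) (nu x) *: nu x.
  apply: normal_direction => v.
  set d := chart_at x; set u := cmap d x.
  have [ad dx] := chart_atP x; rewrite -/d in ad dx.
  have du : cimg d u by exact: cmap_img.
  have [sF _ _] := F_embedding.
  have oimg : open (cimg d) by exact: cimg_open.
  have sFd : vsmooth (cimg d) (F \o cinv d) by apply: vsmooth_smooth => //; exact: sF.
  have sc : vsmooth (cimg d) (fun=> c) by move=> i; exact: smooth_cst.
  have sFc := vsmoothB oimg sFd sc.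
  have spsi := smooth_dot oimg sFc sFc.
  pose L := [set s : R | cimg d (u + s *: v)].
  have oL : open L by exact: line_open.
  have [] := second_derivative_test oL (smooth_line u v oimg spsi).
  - by rewrite /L /= scale0r addr0.
  - rewrite scale0r addr0; near=> s.
    by rewrite /= cmapK// xr; exact: yr.
  rewrite (derive_line (fun y => dot ((F \o cinv d) y - c) ((F \o cinv d) y - c))).
  rewrite scale0r addr0 (derive_dot _ oimg sFc sFc du) => + _.
  rewrite (vderiveB _ sFd sc du).
  have -> : vderive v (fun=> c) u = 0.
    by apply/rowP => i; rewrite vderiveE derive_cst mxE.
  have dFd : differentiable (F \o cinv d) u by have [+ _] := sF d ad 1%N; exact.
  rewrite subr0 /= cmapK// (dotC (F x - c)) -(derive_vderive _ dFd) -mulr2n => /eqP.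
  by rewrite mulrn_eq0/= => /eqP.
set l := dot (F x - c) (nu x) in wE.
have l2 : l ^+ 2 = r x ^+ 2 by rewrite -xr wE dotZl dotZr nu1 mulr1.
have cE : c = F x - l *: nu x by rewrite -wE subKr.
(* On the other side the ball would contain points [F x + s *: nu x] with small positive [s], which
   lie outside [Omega]. *)
have lr : l = r x.
  have /eqP := l2; rewrite eqf_sqr => /orP[/eqP//|/eqP lN].
  have [e e0 eO] := nuO x; exfalso.
  pose s := Num.min e (r x) / 2.
  have s0 : 0 < s by rewrite divr_gt0// lt_min e0 r_gt0.
  have sm : s < Num.min e (r x) by rewrite ltr_pdivrMr// ltr_pMr ?ltr1n// lt_min e0 r_gt0.
  move: sm; rewrite lt_min => /andP[se sr].
  have [|_] := eO s; first by rewrite s0.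
  apply; apply: subset_closure; apply: BO; rewrite eballE//= cE lN.
  have -> : F x + s *: nu x - (F x - - r x *: nu x) = (s - r x) *: nu x.
    by apply/rowP => i; rewrite !mxE; ring.
  rewrite dotZl dotZr nu1 mulr1 -expr2 -sqrrN opprB ltr_pXn2r ?nnegrE ?subr_ge0 ?ltW//.
  by rewrite ltrBlDr ltrDl.
rewrite two_pointE mulr_ge0//; first by rewrite divr_ge0// ltW.
by rewrite subr_ge0 -lr -cE lr; exact: yr.
Unshelve. all: by end_near. Qed.

(** The ball centred at [F x - r x *: nu x] misses the boundary of [Omega] and contains a point of
    [Omega] close to [F x]; being convex, it stays inside [Omega]. *)
Lemma two_point_noncollapsed :
  (forall x y, 0 <= two_point delta (H x) (F x) (F y) (nu x)) ->
  noncollapsed delta F Omega nu.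
Proof.
move=> Z0 x; exists (F x - r x *: nu x).
set c := F x - r x *: nu x; set B := eball c (r x).
have [oO bO] := F_bounds; have [nu1 _ nuO] := nu_normal.
have oB : open B by exact: eball_open.
have BF y : ~ B (F y).
  rewrite /B eballE//= => yr; have := Z0 x y.
  rewrite two_pointE pmulr_rge0 ?divr_gt0// subr_ge0 => ry.
  by have := le_lt_trans ry yr; rewrite ltxx.
have Bs (s : R) : 0 < s < r x -> B (F x - s *: nu x).
  move=> /andP[s0 sr]; rewrite /B eballE//= dot_interior_center.
  by rewrite ltr_pXn2r ?nnegrE ?subr_ge0 ?ltW// ltrBlDr ltrDl.
have [e e0 eO] := nuO x.
pose s0 := Num.min e (r x) / 2.
have s0_gt0 : 0 < s0 by rewrite divr_gt0// lt_min e0 r_gt0.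
have /andP[s0e s0r] : (s0 < e) && (s0 < r x).
  rewrite -lt_min ltr_pdivrMr// ltr_pMr ?ltr1n// lt_min e0; exact: r_gt0.
pose p := F x - s0 *: nu x.
have Bp : B p by apply: Bs; rewrite s0_gt0.
have Op : Omega p by have [|+ _] := eO s0; [rewrite s0_gt0|].
split.
  move=> q Bq.
  pose S := [set p + s *: (q - p) | s in `[0, 1]%classic].
  have cS : connected S.
    apply: connected_continuous_connected; first exact: segment_connected.
    by apply: continuous_subspaceT => s; exact: line_continuous.
  have SB : S `<=` B.
    move=> _ [s /= s01 <-]; apply: eball_convex => //.
  have Sp : S p by exists 0; rewrite ?scale0r ?addr0//= in_itv/= lexx ler01.
  have Sq : S q by exists 1; rewrite ?scale1r ?subrKC//= in_itv/= lexx ler01.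
  (* [Omega] is open and closed relative to the segment, since a limit point outside [Omega] would
     lie on the hypersurface. *)
  have : S `&` Omega = S.
    apply: cS; first by exists p.
      by exists Omega.
    exists (closure Omega); first exact: closed_closure.
    apply/seteqP; split=> y [Sy yO]; split=> //; first exact: subset_closure.
    have [//|nO] := pselect (Omega y).
    have : boundary Omega y by split=> //; rewrite (interior_id _).1.
    by rewrite bO => -[y' _ y'E]; case: (BF y'); rewrite y'E; exact: SB.
  by move=> SO; have : S q by []; rewrite -SO => -[].
split; last by move=> /interior_subset; exact: BF.
move=> V nV.
have cl : (F x - s *: nu x) @[s --> (0 : R)^'+] --> F x.
  have : (F x + s *: (- nu x)) @[s --> (0 : R)] --> F x.
    have cc : continuous (fun s : R => F x + s *: (- nu x)) by exact: line_continuous.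
    by have := cc 0; rewrite /continuous_at scale0r addr0.
  move=> h; under eq_fun do rewrite -scalerN; exact: cvg_at_right_filter.
have : \forall s \near (0 : R)^'+, V (F x - s *: nu x) /\ B (F x - s *: nu x).
  near=> s; split; first by near: s; exact: cl.
  by apply: Bs; apply/andP; split; near: s; [exact: nbhs_right_gt|exact: nbhs_right_lt].
by move=> /filter_ex[s [Vs Bs']]; exists (F x - s *: nu x).
Unshelve. all: by end_near. Qed.

End Noncollapsed.

(** * The maximum principle *)

Lemma is_derive_scaled_expR (R : realType) (b K : R) :
  is_derive (0 : R) 1 (fun s : R => b * expR (K * s)) (b * K).
Proof.
have hK : is_derive (0 : R) (1 : R) (K \*: id) (K *: 1) by exact: is_deriveZ.
have hE : is_derive ((K \*: (id : R -> R)) (0 : R)) (1 : R) expR 1.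
  by apply: is_derive_eq; rewrite /= [K *: 0]mulr0 expR0.
have hc := is_derive1_comp hE hK.
have := @is_deriveZ _ _ _ _ b _ _ _ hc.
by rewrite mul1r [b *: _]/(b * _) [K *: 1]mulr1.
Qed.

Section MaximumPrinciple.
Variables (R : realType) (n : nat) (M : smoothManifold R n) (T : \bar R).
Hypothesis M_compact : compact [set: M].
Variables (X nu : M -> R -> 'rV[R]_n.+1) (Omega : R -> set 'rV[R]_n.+1).
Hypothesis X_smooth : smooth_family T X.
Hypothesis X_embedding : forall t, time_interval T t -> smooth_embedding (X^~ t).
Hypothesis nu_normal : forall t, time_interval T t ->
  outward_unit_normal (X^~ t) (Omega t) (nu^~ t).
Hypothesis X_mcf : mean_curvature_flow T X nu.
Hypothesis H_gt0 : forall x t, time_interval T t ->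
  0 < mean_curvature (X^~ t) (nu^~ t) x.
Variable delta : R.
Hypothesis delta_gt0 : 0 < delta.

Local Notation I := (time_interval T).
Local Notation mc x t := (mean_curvature (X^~ t) (nu^~ t) x).
Local Notation E := ('rV[R]_n * R)%type.
Local Notation dt := ((0 : 'rV[R]_n), (1 : R)).

Definition flow_two_point (x y : M) (t : R) : R :=
  two_point delta (mc x t) (X x t) (X y t) (nu x t).

Lemma near_chart (c : chart R n M) (U : set E) x0 t0 : cdom c x0 -> open U ->
  U (cmap c x0, t0) -> \forall p \near (x0, t0), cdom c p.1 /\ U (cmap c p.1, p.2).
Proof.
move=> cx oU U0.
have h1 : \forall p \near (x0, t0), cdom c p.1.
  apply: (@cvg_fst _ _ (nbhs x0) (nbhs t0)).
  by apply: open_nbhs_nbhs; split=> //; exact: cdom_open.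
have c1 : cmap c p.1 @[p --> (x0, t0)] --> cmap c x0.
  have := cmap_continuous cx; rewrite /prop_for /continuous_at => h.
  exact: (cvg_comp _ _ (@cvg_fst _ _ (nbhs x0) (nbhs t0) _) h).
have c2 : p.2 @[p --> (x0, t0)] --> t0 by exact: cvg_snd.
have nU : nbhs (cmap c x0, t0) U by exact: open_nbhs_nbhs.
have h2 : \forall p \near (x0, t0), U (cmap c p.1, p.2) by exact: (cvg_pair c1 c2 nU).
exact: filterI h1 h2.
Qed.

Lemma cvg_two_point (P : Type) (F : set_system P) (FF : Filter F) (h : P -> R)
    (p q v : P -> 'rV[R]_n.+1) (h0 : R) (p0 q0 v0 : 'rV[R]_n.+1) :
  h x @[x --> F] --> h0 -> (forall i, p x 0 i @[x --> F] --> p0 0 i) ->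
  (forall i, q x 0 i @[x --> F] --> q0 0 i) -> (forall i, v x 0 i @[x --> F] --> v0 0 i) ->
  two_point delta (h x) (p x) (q x) (v x) @[x --> F] --> two_point delta h0 p0 q0 v0.
Proof.
move=> ch cp cq cv.
have cd i : (q x - p x) 0 i @[x --> F] --> (q0 - p0) 0 i.
  by under eq_fun do rewrite !mxE; rewrite !mxE; exact: cvgB.
apply: cvgD; apply: cvgM.
- by apply: cvgM => //; exact: cvg_cst.
- exact: cvg_dot.
- exact: cvg_cst.
- exact: cvg_dot.
Qed.

Lemma flow_two_point_near x0 y0 t0 e : I t0 -> 0 < e ->
  \forall p \near ((x0, y0), t0), I p.2 ->
    `|flow_two_point x0 y0 t0 - flow_two_point p.1.1 p.1.2 p.2| < e.
Proof.
move=> It0 e0.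
have [c [U [g [N [H [[cx oU Uz] [[sg sN sH _] [gE _]]]]]]]] :=
  extended_patch X_smooth X_embedding nu_normal X_mcf H_gt0 x0 It0.
have [c' [U' [g' [N' [H' [[cy oU' Uz'] [[sg' _ _ _] [gE' _]]]]]]]] :=
  extended_patch X_smooth X_embedding nu_normal X_mcf H_gt0 y0 It0.
pose p0 : M * M * R := ((x0, y0), t0).
have c11 : p.1.1 @[p --> p0] --> x0.
  exact: (cvg_comp _ _ (@cvg_fst _ _ (nbhs (x0, y0)) (nbhs t0) _) (@cvg_fst _ _ (nbhs x0) (nbhs y0) _)).
have c12 : p.1.2 @[p --> p0] --> y0.
  exact: (cvg_comp _ _ (@cvg_fst _ _ (nbhs (x0, y0)) (nbhs t0) _) (@cvg_snd _ _ (nbhs x0) (nbhs y0) _)).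
have ct : p.2 @[p --> p0] --> t0 by exact: cvg_snd.
have c1 : (p.1.1, p.2) @[p --> p0] --> (x0, t0).
  by move=> A nA; exact: (cvg_pair c11 ct nA).
have c2 : (p.1.2, p.2) @[p --> p0] --> (y0, t0).
  by move=> A nA; exact: (cvg_pair c12 ct nA).
have chart_cvg (d : chart R n M) w : cdom d w ->
    (cmap d p.1, p.2) @[p --> (w, t0)] --> (cmap d w, t0).
  move=> dw; have := cmap_continuous dw; rewrite /prop_for /continuous_at => h.
  have h1 : cmap d p.1 @[p --> (w, t0)] --> cmap d w.
    exact: (cvg_comp _ _ (@cvg_fst _ _ (nbhs w) (nbhs t0) _) h).
  have h2 : p.2 @[p --> (w, t0)] --> t0 by exact: cvg_snd.
  by move=> A nA; exact: (cvg_pair h1 h2 nA).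
have z1 : (cmap c p.1.1, p.2) @[p --> p0] --> (cmap c x0, t0).
  exact: (cvg_comp _ _ c1 (chart_cvg c x0 cx)).
have z2 : (cmap c' p.1.2, p.2) @[p --> p0] --> (cmap c' y0, t0).
  exact: (cvg_comp _ _ c2 (chart_cvg c' y0 cy)).
have cH : H (cmap c p.1.1, p.2) @[p --> p0] --> H (cmap c x0, t0).
  exact: (cvg_comp _ _ z1 (smooth_continuous sH Uz)).
have cg i : g (cmap c p.1.1, p.2) 0 i @[p --> p0] --> g (cmap c x0, t0) 0 i.
  exact: (cvg_comp _ _ z1 (smooth_continuous (sg i) Uz)).
have cN i : N (cmap c p.1.1, p.2) 0 i @[p --> p0] --> N (cmap c x0, t0) 0 i.
  exact: (cvg_comp _ _ z1 (smooth_continuous (sN i) Uz)).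
have cg' i : g' (cmap c' p.1.2, p.2) 0 i @[p --> p0] --> g' (cmap c' y0, t0) 0 i.
  exact: (cvg_comp _ _ z2 (smooth_continuous (sg' i) Uz')).
have Fp : Filter (nbhs p0) by typeclasses eauto.
have cZ := cvg_two_point Fp cH cg cg' cN.
have nU : \forall p \near p0, cdom c p.1.1 /\ U (cmap c p.1.1, p.2).
  exact: (c1 _ (near_chart cx oU Uz)).
have nU' : \forall p \near p0, cdom c' p.1.2 /\ U' (cmap c' p.1.2, p.2).
  exact: (c2 _ (near_chart cy oU' Uz')).
have value x y t : I t -> cdom c x -> U (cmap c x, t) -> cdom c' y -> U' (cmap c' y, t) ->
    flow_two_point x y t = two_point delta (H (cmap c x, t)) (g (cmap c x, t))
      (g' (cmap c' y, t)) (N (cmap c x, t)).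
  move=> It dx Ux dy Uy; rewrite /flow_two_point.
  have [_ /(_ It)[/= + + +]] := gE _ Ux; rewrite cmapK// => -> -> ->.
  by have [_ /(_ It)[/= + _ _]] := gE' _ Uy; rewrite cmapK// => ->.
have nZ : \forall p \near p0, `|two_point delta (H (cmap c x0, t0)) (g (cmap c x0, t0))
      (g' (cmap c' y0, t0)) (N (cmap c x0, t0))
    - two_point delta (H (cmap c p.1.1, p.2)) (g (cmap c p.1.1, p.2))
      (g' (cmap c' p.1.2, p.2)) (N (cmap c p.1.1, p.2))| < e.
  by move/cvgrPdist_lt: cZ; apply.
apply: filterS (filterI nU (filterI nU' nZ)) => p [[dx Ux] [[dy Uy] pe]] Ip.
by rewrite !value.
Qed.

(* The bounded quantities are those entering two_point_evolution. *)
Definition bounded_patch (C : R) (x : M) (t : R) :=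
  exists (c : chart R n M) (U : set E) (g N : E -> 'rV[R]_n.+1) (H : E -> R),
  [/\ cdom c x, U (cmap c x, t) & flow_patch U g N H] /\
  (forall z, U z -> [/\ X (cinv c z.1) z.2 = g z, nu (cinv c z.1) z.2 = N z &
     mc (cinv c z.1) z.2 = H z]) /\
  [/\ shape_norm2 g N (cmap c x, t) <= C,
      dot (vderive dt N (cmap c x, t)) (vderive dt N (cmap c x, t)) <= C &
      H (cmap c x, t) <= C].

(** Stated for all large [C], the form in which compactness by near coverings yields one constant
    for all points. *)
Lemma bounded_patch_near x0 t0 : I t0 ->
  \forall p \near ((x0, t0) : M * R) & C \near pinfty_nbhs R, I p.2 -> 0 < p.2 -> bounded_patch C p.1 p.2.
Proof.
move=> It0.
have [c [U [g [N [H [[cx oU Uz] [[sg sN sH sA] [gE pE]]]]]]]] :=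
  extended_patch X_smooth X_embedding nu_normal X_mcf H_gt0 x0 It0.
have sG : smooth_on_open U (fun z => dot (vderive dt N z) (vderive dt N z)).
  by apply: smooth_dot => //; exact: vsmooth_vderive.
set z0 := (cmap c x0, t0) in Uz.
have bnd (f : E -> R) : smooth_on_open U f ->
    \forall z \near z0, f z <= f z0 + 1.
  move=> sf; have := smooth_continuous sf Uz; rewrite /prop_for /continuous_at.
  by move=> /cvgr_le; apply; rewrite ltrDl.
pose C0 := `|shape_norm2 g N z0| + `|dot (vderive dt N z0) (vderive dt N z0)| + `|H z0| + 1.
pose V := U `&` interior [set z | [/\ shape_norm2 g N z <= C0,
  dot (vderive dt N z) (vderive dt N z) <= C0 & H z <= C0]].
have oV : open V by apply: openI => //; exact: open_interior.
have Vz : V z0.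
  split=> //; rewrite /interior /=.
  apply: filterS (filterI (bnd _ sA) (filterI (bnd _ sG) (bnd _ sH))) => z [a1 [a2 a3]]; split.
  - apply: le_trans a1 _; rewrite lerD2r -addrA.
    by rewrite (le_trans (ler_norm _))// lerDl addr_ge0.
  - apply: le_trans a2 _; rewrite lerD2r -addrA addrCA.
    by rewrite (le_trans (ler_norm _))// lerDl addr_ge0.
  - apply: le_trans a3 _; rewrite lerD2r addrC.
    by rewrite (le_trans (ler_norm _))// lerDl addr_ge0.
have nV := near_chart cx oV Vz.
have nC : \forall C \near +oo, C0 <= C by apply: nbhs_pinfty_ge; exact: num_real.
exists ([set p | cdom c p.1 /\ V (cmap c p.1, p.2)], [set C | C0 <= C]) => //=.
move=> [p C] /= [[dp [Up /interior_subset[b1 b2 b3]]] CC] Ip p0.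
exists c, (U `&` [set z | 0 < z.2 /\ (z.2%:E < T)%E]), g, N, H; split; last split.
- by split=> //; split=> //; split=> //; case: Ip.
- move=> z [Uz' [z0' zT]]; have [_] := gE z Uz'; apply.
  by split=> //; exact: ltW.
- by split; exact: le_trans CC.
Qed.

(** The local bounds hold on neighbourhoods reaching across time 0, so [C] does not degenerate as
    [t] tends to 0, although patches exist only for [t > 0]. *)
Lemma uniform_bounded_patch t1 : I t1 ->
  exists C, forall x t, 0 < t <= t1 -> bounded_patch C x t.
Proof.
move=> It1; have [t10 t1T] := It1.
have cK : compact ([set: M] `*` `[0, t1]%classic).
  by apply: compact_setX => //; exact: segment_compact.
have /compact_near_coveringP/(_ R (pinfty_nbhs R)) nc := cK.
have It t : 0 <= t <= t1 -> I t.
  move=> /andP[t0 tt1]; split=> //; apply: le_lt_trans t1T.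
  by rewrite lee_fin.
have FF : Filter (pinfty_nbhs R) by typeclasses eauto.
have [|C [Cr CP]] := nc (fun C p => I p.2 -> 0 < p.2 -> bounded_patch C p.1 p.2) FF.
  move=> [x t] [_ /=]; rewrite in_itv/= => tt1.
  exact: (bounded_patch_near x (It _ tt1)).
(* Neighbourhoods of +oo are given by strict inequalities, hence [C + 1]. *)
exists (C + 1) => x t /andP[t0 tt1].
have tt : 0 <= t <= t1 by rewrite ltW.
apply: (CP (C + 1) _ (x, t)) => //=; first by rewrite ltrDl.
exact: It.
Qed.

(** Positivity need persist only within [K], as the two-point function is controlled only at times
    of [I]; cluster points replace closedness. *)
Lemma compact_sublevel (S : topologicalType) (K : set S) (f : S -> R) : compact K ->
  (forall p, K p -> 0 < f p -> \forall q \near p, K q -> 0 < f q) ->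
  compact (K `&` [set p | f p <= 0]).
Proof.
move=> cK fK F PF FA.
have FK : F K by apply: filterS FA => p [].
have [p [Kp clp]] := cK F PF FK.
exists p; split=> //; split=> //=; rewrite leNgt; apply/negP => fp.
have [q [[Kq /= fq] fq0]] := clp _ _ FA (fK p Kp fp).
by have := lt_le_trans (fq0 Kq) fq; rewrite ltxx.
Qed.

(** One-sided, because at a first touching time only earlier times are controlled. *)
Lemma derive_le0_left (f : R -> R) : derivable f 0 1 ->
  (\forall s \near 0, s < 0 -> f 0 <= f s) -> 'D_1 f 0 <= 0.
Proof.
move=> df nf; rewrite leNgt; apply/negP => D0.
have /cvgr_gt/(_ 0 D0)/nbhs_ballP[e /= e0 eP] := df.
have /nbhs_ballP[d /= d0 dP] := nf.
pose s := - (Num.min e d / 2).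
have m0 : 0 < Num.min e d by rewrite lt_min e0.
have s0 : s < 0 by rewrite oppr_lt0 divr_gt0.
have sm : `|s| < Num.min e d by rewrite normrN gtr0_norm ?divr_gt0// ltr_pdivrMr// ltr_pMr ?ltr1n.
move: sm; rewrite lt_min => /andP[se sd].
have := eP s; rewrite -ball_normE /ball_/= sub0r normrN => /(_ se).
rewrite lt_eqF// => /(_ isT); rewrite [s *: 1]mulr1 addr0.
rewrite -[_ *: _]/(s^-1 * _) nmulr_rgt0 ?invr_lt0// subr_lt0 ltNge => /negP; apply.
by apply: dP => //; rewrite -ball_normE /ball_/= sub0r normrN.
Qed.

(** * The differential inequality at the first touching time *)

Section FirstTime.
Variables (x0 y0 : M) (t0 C K b : R).
Hypothesis It0 : I t0.
Hypothesis t0_gt0 : 0 < t0.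
Hypothesis px : bounded_patch C x0 t0.
Hypothesis py : bounded_patch C y0 t0.
Hypothesis b_gt0 : 0 < b.
Hypothesis b_small : 4 * C * b <= delta ^+ 2.
Hypothesis Zmin : forall x y, - b <= flow_two_point x y t0.
Hypothesis Z0 : flow_two_point x0 y0 t0 = - b.
Hypothesis Zleft : \forall s \near 0, s < 0 ->
  - b * expR (K * s) <= flow_two_point x0 y0 (t0 + s).

(** Touching the barrier from above gives Z_t <= - b K, while the evolution inequality with Z = - b
    gives Z_t >= - b L for its coefficient [L]; so K <= L, and [L] is bounded by the patch
    constants. *)
Lemma first_time_rate : K <= C + 1 + 2 * C / delta ^+ 2.
Proof.
have [c [U [g [N [H [[cx Uz PF] [gE [bA bG bH]]]]]]]] := px.
have [c' [U' [g' [N' [H' [[cy Uz' PQ] [gE' _]]]]]]] := py.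
set z := (cmap c x0, t0) in Uz bA bG bH; set z' := (cmap c' y0, t0) in Uz'.
have oU := patch_open PF; have oU' := patch_open PQ.
have value y y' : U y -> U' y' -> y.2 = y'.2 ->
    two_point delta (H y) (g y) (g' y') (N y)
    = flow_two_point (cinv c y.1) (cinv c' y'.1) y.2.
  move=> Uy Uy' e; rewrite /flow_two_point; have [-> -> ->] := gE y Uy.
  by rewrite e; have [-> _ _] := gE' y' Uy'.
have Zz : two_point delta (H z) (g z) (g' z') (N z) = - b.
  by rewrite value//= !cmapK.
have nmin : \forall y \near z & y' \near z', y.2 = z.2 -> y'.2 = z'.2 ->
    two_point delta (H z) (g z) (g' z') (N z) <= two_point delta (H y) (g y) (g' y') (N y).
  exists (U, U') => /=; first by split; exact: open_nbhs_nbhs.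
  move=> [y y'] /= [Uy Uy'] e e'; rewrite Zz value ?e ?e'//.
have Hz : 0 < H z.
  by have [_ _ <-] := gE z Uz; exact: H_gt0.
have rho2 := two_point_rho PF PQ Uz Uz' nmin.
have evo := two_point_evolution PF PQ Uz Uz' nmin.
set rho := dot (H z *: (g' z' - g z) + delta *: N z) (N' z') in rho2 evo.
rewrite Zz in rho2 evo.
have d2 : 0 < delta ^+ 2 by rewrite exprn_gt0.
have Hb : H z * b <= C * b by rewrite ler_pM2r.
(* [b_small] is calibrated so that, with [H z <= C], the term [2 * H z * b] costs at most half of
   [delta ^+ 2]. *)
have rho2_ge : delta ^+ 2 / 2 <= rho ^+ 2.
  rewrite rho2; have aux (d h c1 b1 : R) :
    4 * c1 * b1 <= d -> h * b1 <= c1 * b1 -> d / 2 <= d + 2 * h * - b1 by lra.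
  exact: aux b_small Hb.
have rho2_gt0 : 0 < rho ^+ 2 by apply: lt_le_trans rho2_ge; rewrite divr_gt0.
have rho0 : rho != 0 by apply: contraTneq rho2_gt0 => ->; rewrite expr0n ltxx.
move: (evo rho0); set L := shape_norm2 g N z + _ => evoL.
(* With w = gm / rho, the gradient term is 2 w <= 1 + w^2, whatever the sign of [rho];
   Cauchy-Schwarz bounds gm^2 by [C], and rho^2 is at least [delta ^+ 2 / 2]. *)
have LC : L <= C + 1 + 2 * C / delta ^+ 2.
  rewrite /L -addrA lerD//.
  set gm := dot _ (N' z').
  have gm2 : gm ^+ 2 <= C.
    by apply: le_trans bG; apply: dot_unit_le; exact: (patch_unit PQ).
  have C0 : 0 <= C by apply: le_trans gm2; exact: sqr_ge0.
  have h1 : (gm / rho) ^+ 2 <= 2 * C / delta ^+ 2.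
    rewrite expr_div_n ler_pdivrMr// mulrAC ler_pdivlMr//.
    apply: (@le_trans _ _ (C * delta ^+ 2)); first by rewrite ler_wpM2r// ltW.
    rewrite [2 * C]mulrC -mulrA ler_wpM2l//.
    by rewrite mulrC -ler_pdivrMr.
  have h2 : 2 * (gm / rho) <= 1 + (gm / rho) ^+ 2.
    have := sqr_ge0 (gm / rho - 1); move: (gm / rho) => w; lra.
  by rewrite -mulrA; apply: le_trans h2 _; rewrite lerD2l.
apply: le_trans LC.
set f := fun s : R => two_point delta (H (z + s *: dt)) (g (z + s *: dt))
  (g' (z' + s *: dt)) (N (z + s *: dt)).
have fsm := smooth_two_point_line PF PQ z z' delta dt dt.
have [oW W0] := two_point_line_open PF PQ Uz Uz' dt dt.
have df : derivable f 0 1 by exact: smooth_derivable fsm W0.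
have [dK DK] := is_derive_scaled_expR b K.
have f0 : f 0 = - b by rewrite /f !scale0r !addr0.
have : 'D_1 (fun s : R => f s + b * expR (K * s)) 0 <= 0.
  apply: derive_le0_left; first exact: derivableD.
  rewrite f0 mulr0 expR0 mulr1 addNr.
  have nW : \forall s \near 0, U (z + s *: dt) /\ U' (z' + s *: dt) by exact: open_nbhs_nbhs.
  apply: filterS (filterI nW Zleft) => s [[Us Us'] h] s0.
  rewrite /f value//=; rewrite !scaler0 !addr0 !cmapK// [s *: 1]mulr1.
  by have := h s0; rewrite mulNr -subr_ge0 opprK.
rewrite deriveD// DK => h.
have : b * (K - L) <= 0 by move: evoL h; rewrite -/f; lra.
by rewrite pmulr_rle0// subr_le0.
Qed.

End FirstTime.

Hypothesis Z0_ge0 : forall x y, 0 <= flow_two_point x y 0.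

Lemma flow_two_point_ge0 t1 x y : I t1 -> 0 <= flow_two_point x y t1.
Proof.
move=> It1; have [t10 _] := It1; rewrite leNgt; apply/negP => Zneg.
have [C CP] := uniform_bounded_patch It1.
(* Exceeds the bound of [first_time_rate] by at least one. *)
pose K := `|C| + 2 + 2 * `|C| / delta ^+ 2.
have d2 : 0 < delta ^+ 2 by rewrite exprn_gt0.
have It t : 0 <= t <= t1 -> I t.
  move=> /andP[t0 tt1]; split=> //; have [_] := It1.
  by apply: le_lt_trans; rewrite lee_fin.
(* The first argument of the minimum makes the barrier reached at [(x, y, t1)], the second yields
   [b_small]; dividing by [expR (K * t1)] keeps [eps * expR (K * t)] below both up to time [t1]. *)
pose eps := Num.min (- flow_two_point x y t1) (delta ^+ 2 / (4 * (`|C| + 1))) / expR (K * t1).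
have C1 : 0 < 4 * (`|C| + 1) by rewrite mulr_gt0// ltr_wpDl.
have eps0 : 0 < eps.
  by rewrite divr_gt0 ?expR_gt0// lt_min oppr_gt0 Zneg divr_gt0.
pose W (p : M * M * R) := flow_two_point p.1.1 p.1.2 p.2 + eps * expR (K * p.2).
pose S : set (M * M * R) := ([set: M] `*` [set: M]) `*` `[0, t1]%classic.
have cS : compact S.
  by apply: compact_setX; [exact: compact_setX|exact: segment_compact].
have SI p : S p -> I p.2 by move=> [_ /=]; rewrite in_itv/=; exact: It.
have Wnear p e : I p.2 -> 0 < e -> \forall q \near p, I q.2 -> `|W p - W q| < e.
  move: p => [[x' y'] t'] Ip e0 /=.
  have e2 : 0 < e / 2 by rewrite divr_gt0.
  have n1 := flow_two_point_near x' y' Ip e2.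
  have cE : eps * expR (K * q.2) @[q --> ((x', y'), t')] --> eps * expR (K * t').
    have c1 : q.2 @[q --> ((x', y'), t')] --> t' by exact: cvg_snd.
    have c2 : K * q.2 @[q --> ((x', y'), t')] --> K * t'.
      by apply: cvgM => //; exact: cvg_cst.
    have c3 := cvg_comp _ _ c2 (@continuous_expR R (K * t')).
    by apply: cvgM; [exact: cvg_cst|exact: c3].
  have n2 : \forall q \near ((x', y'), t'), `|eps * expR (K * t') - eps * expR (K * q.2)| < e / 2.
    by move/cvgrPdist_lt: cE; apply.
  apply: filterS (filterI n1 n2) => q [h1 h2] Iq; have := h1 Iq; move: h2.
  rewrite /W /=.
  move: (flow_two_point _ _ _) (flow_two_point _ _ _) (eps * _) (eps * _) => a1 a2 a3 a4 h2' h1'.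
  rewrite (_ : a2 + a4 - (a1 + a3) = (a2 - a1) + (a4 - a3)); last by ring.
  by rewrite (le_lt_trans (ler_normD _ _))// [ltRHS](splitr e) ltrD.
pose A := S `&` [set p | W p <= 0].
have cA : compact A.
  apply: compact_sublevel => // p Sp Wp.
  apply: filterS (Wnear p (W p) (SI p Sp) Wp) => q h Sq.
  have := h (SI q Sq); rewrite ltr_norml => /andP[_]; lra.
have A0 : A !=set0.
  exists ((x, y), t1); split; first by split=> //=; rewrite in_itv/= t10 lexx.
  rewrite /W /= /eps divfK ?gt_eqF ?expR_gt0//.
  by rewrite -lerBrDl sub0r ge_min lexx.
(* The earliest time at which the barrier is reached anywhere: the time coordinate attains its
   minimum on the compact set [A]. *)
have [[[x0 y0] t0] + tmin] : exists2 p, p \in A & forall q, q \in A -> p.2 <= q.2.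
  apply: (@compact_EVT_min _ R (fun p : M * M * R => p.2) A A0 cA).
  by apply: continuous_subspaceT => p; exact: cvg_snd.
rewrite inE => -[[_ /=]]; rewrite in_itv/= => /andP[t00 t0t1] Wp0.
have {}tmin q : A q -> t0 <= q.2 by move=> Aq; apply: (tmin q); rewrite inE.
have It0 : I t0 by apply: It; rewrite t00.
have t0_gt0 : 0 < t0.
  rewrite lt_def t00 andbT; apply: contraTneq Wp0 => ->.
  by rewrite /W /= mulr0 expR0 mulr1 -ltNge ltr_wpDl.
have Wlt x' y' t : 0 <= t < t0 -> 0 < W ((x', y'), t).
  move=> /andP[t_ge0 tt0]; rewrite ltNge; apply/negP => Wle.
  have : t0 <= t; last by rewrite leNgt tt0.
  apply: (tmin ((x', y'), t)); split=> //; split=> //=.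
  by rewrite in_itv/= t_ge0 (le_trans (ltW tt0)).
(* [W] is positive before [t0], so continuity from the left excludes negative values at [t0]; thus
   [(x0, y0)] is a spatial minimum with value 0. *)
have Wge x' y' : 0 <= W ((x', y'), t0).
  rewrite leNgt; apply/negP => Wneg.
  have nW := Wnear ((x', y'), t0) (- W ((x', y'), t0)) It0 _.
  have {}nW := nW ltac:(by rewrite oppr_gt0).
  have ct : ((x', y'), t) @[t --> t0] --> ((x', y'), t0).
    by move=> B nB; exact: (cvg_pair (cvg_cst (x', y')) (@cvg_id _ (nbhs t0)) nB).
  have n3 : \forall t \near t0, I t ->
      `|W ((x', y'), t0) - W ((x', y'), t)| < - W ((x', y'), t0) by exact: (ct _ nW).
  have : \forall t \near t0^'-, [/\ t < t0, 0 < t & I t ->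
      `|W ((x', y'), t0) - W ((x', y'), t)| < - W ((x', y'), t0)].
    near=> t; split.
    - by near: t; exact: nbhs_left_lt.
    - by near: t; exact: nbhs_left_gt.
    - by near: t; apply: cvg_within; exact: n3.
  move=> /filter_ex[t [tt0 t_gt0 h]].
  have Wt := Wlt x' y' t; rewrite (ltW t_gt0) tt0 in Wt.
  have := h (It t _); rewrite (ltW t_gt0) (le_trans (ltW tt0))// => /(_ isT).
  rewrite ltr_norml => /andP[+ _]; have := Wt isT; lra.
have b0 : 0 < eps * expR (K * t0) by rewrite mulr_gt0 ?expR_gt0.
have Wp0' : W ((x0, y0), t0) = 0 by apply/eqP; rewrite eq_le Wp0 Wge.
have tt : 0 < t0 <= t1 by rewrite t0_gt0.
have K0 : 0 <= K by rewrite addr_ge0 ?divr_ge0 ?mulr_ge0 ?addr_ge0// ltW.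
have b_le : eps * expR (K * t0) <= delta ^+ 2 / (4 * (`|C| + 1)).
  apply: (@le_trans _ _ (eps * expR (K * t1))).
    by rewrite ler_pM2l// ler_expR ler_wpM2l.
  by rewrite /eps divfK ?gt_eqF ?expR_gt0// ge_min lexx orbT.
have b_small : 4 * C * (eps * expR (K * t0)) <= delta ^+ 2.
  move: b_le; rewrite ler_pdivlMr//; apply: le_trans.
  rewrite [leRHS]mulrC ler_pM2r// ler_pM2l// (le_trans (ler_norm _))// lerDl//.
have Zmin x' y' : - (eps * expR (K * t0)) <= flow_two_point x' y' t0.
  by have := Wge x' y'; rewrite /W /= -lerBlDr sub0r.
have Zeq : flow_two_point x0 y0 t0 = - (eps * expR (K * t0)).
  by move/eqP: Wp0'; rewrite /W /= addr_eq0 => /eqP.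
have Zleft : \forall s \near 0, s < 0 ->
    - (eps * expR (K * t0)) * expR (K * s) <= flow_two_point x0 y0 (t0 + s).
  have nt : \forall s \near (0 : R), - t0 < s.
    by apply: open_nbhs_nbhs; split; [exact: open_gt|rewrite /= oppr_lt0].
  apply: filterS nt => s ts s0.
  have ts' : 0 <= t0 + s < t0 by rewrite gtrDl s0 andbT -lerBlDl sub0r ltW.
  have := Wlt x0 y0 _ ts'; rewrite /W /= mulrDr expRD mulrA -ltrBlDr sub0r mulNr.
  exact: ltW.
have := first_time_rate It0 (CP _ _ tt) (CP _ _ tt) b0 b_small Zmin Zeq Zleft.
have CC : C <= `|C| by exact: ler_norm.
have CC2 : 2 * C / delta ^+ 2 <= 2 * `|C| / delta ^+ 2.
  by rewrite ler_pM2r ?invr_gt0// ler_pM2l.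
have KC (a c p q : R) : c <= a -> q <= p -> a + 2 + p <= c + 1 + q -> False by lra.
exact: KC CC CC2.
Unshelve. all: by end_near. Qed.

End MaximumPrinciple.

Theorem theorem3 (R : realType) (n : nat) (n_ge1 : (1 <= n)%N)
  (M : smoothManifold R n) (M_compact : compact [set: M])
  (T : \bar R) (T_gt0 : (0 < T)%E)
  (X : M -> R -> 'rV[R]_n.+1)
  (Omega : R -> set 'rV[R]_n.+1)
  (nu : M -> R -> 'rV[R]_n.+1)
  (X_smooth : smooth_family T X)
  (X_embedding : forall t, time_interval T t -> smooth_embedding (X^~ t))
  (Omega_bounds : forall t, time_interval T t -> bounds (X^~ t) (Omega t))
  (nu_normal : forall t, time_interval T t ->
    outward_unit_normal (X^~ t) (Omega t) (nu^~ t))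
  (nu_continuous : forall x, {within time_interval T, continuous (nu x)})
  (X_mcf : mean_curvature_flow T X nu)
  (H_gt0 : forall x t, time_interval T t ->
    0 < mean_curvature (X^~ t) (nu^~ t) x)
  (delta : R) (delta_gt0 : 0 < delta)
  (noncollapsed0 : noncollapsed delta (X^~ 0) (Omega 0) (nu^~ 0)) :
  forall t, time_interval T t ->
    noncollapsed delta (X^~ t) (Omega t) (nu^~ t).
Proof.
have I0 : time_interval T 0 by split.
move=> t It.
apply: (two_point_noncollapsed (Omega_bounds t It) (nu_normal t It)
  (fun x => H_gt0 x t It) delta_gt0) => x y.
apply: (flow_two_point_ge0 M_compact X_smooth X_embedding nu_normal X_mcf H_gt0
  delta_gt0 _ x y It) => {}x {}y.
exact: (noncollapsed_two_point (X_embedding 0 I0) (Omega_bounds 0 I0) (nu_normal 0 I0)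
  (fun x => H_gt0 x 0 I0) delta_gt0 noncollapsed0).
Qed.
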